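(* Let $\Delta\ge 0$, let $n\ge 1$ be an integer, and let $f_0:\mathcal X^n\to\mathbb R^n$ be Lipschitz on bounded sets with $f_0(0)=0$. Assume that there exist a functional $V:\mathcal X^n\to\mathbb R_{\ge 0}$ which is Lipschitz on bounded sets, and constants $\underline a,\overline a,a>0$ and $c\ge 0$ such that, for all $\phi\in\mathcal X^n$, $$\underline a|\phi(0)|^2\le V(\phi)\le \overline a\|\phi\|^2,\qquad D^+V(\phi,f_0(\phi))\le -a|\phi(0)|^2+c\|\phi\|^2.$$ Assume further that there exist a symmetric positive definite matrix $P\in\mathbb R^{n\times n}$ and a constant $\sigma>0$ such that, for all $\phi\in\mathcal X^n$, $$\phi(0)^\top P f_0(\phi)\ge -\sigma\|\phi\|^2.$$ Then there exists a constant $\bar c>0$ such that, if $c\in[0,\bar c)$, the origin of $\dot x(t)=f_0(x_t)$ is globally exponentially stable.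
   Context: $\mathcal X^n$ is the set of continuous functions $\phi:[-\Delta,0]\to\mathbb R^n$, with $\|\phi\|=\max_{\tau\in[-\Delta,0]}|\phi(\tau)|$, where $|\cdot|$ is the Euclidean norm. A map is Lipschitz on bounded sets if its restriction to every bounded set is Lipschitz. For a continuous $x:[-\Delta,T)\to\mathbb R^n$ and $t\in[0,T)$, $x_t\in\mathcal X^n$ is $x_t(\tau):=x(t+\tau)$, $\tau\in[-\Delta,0]$. The solution of $\dot x(t)=f_0(x_t)$ from $x_0\in\mathcal X^n$ is the unique maximal solution. Driver derivative: for $V:\mathcal X^n\to\mathbb R_{\ge 0}$, $\phi\in\mathcal X^n$, $w\in\mathbb R^n$, $D^+V(\phi,w):=\limsup_{h\to 0^+}\frac{V(\phi_{h,w})-V(\phi)}{h}$, where for $h\in[0,\Delta)$, $\phi_{h,w}(s):=\phi(s+h)$ if $s\in[-\Delta,-h)$ and $\phi_{h,w}(s):=\phi(0)+(h+s)w$ if $s\in[-h,0]$. (If $\Delta=0$, $\mathcal X^n$ is identified with $\mathbb R^n$ and $\phi_{h,w}:=\phi(0)+hw$ for $h\geq 0$.) Global exponential stability (GES): the origin of $\dot x(t)=f_0(x_t)$ is GES if there exist $k,\eta>0$ such that, for all $x_0\in\mathcal X^n$, the corresponding solution exists for all $t\ge 0$ and satisfies $|x(t)|\le k\|x_0\|e^{-\eta t}$ for all $t\ge 0$. *)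

(* Defs.v *)
From HB Require Import structures.
From mathcomp Require Import all_boot all_order all_algebra.
From mathcomp Require Import all_classical all_reals all_analysis.

Set Implicit Arguments.
Unset Strict Implicit.
Unset Printing Implicit Defensive.

Import Order.TTheory GRing.Theory Num.Theory numFieldNormedType.Exports.
Local Open Scope classical_set_scope.
Local Open Scope ring_scope.

(* The library norm on 'cV[R]_n is the max norm, which induces the same
   topology and the same derivatives. *)
Definition enorm (R : realType) (n : nat) (v : 'cV[R]_n) : R :=
  Num.sqrt (\sum_(i < n) v i 0 ^+ 2).

Definition posdef (R : realType) (n : nat) (P : 'M[R]_n) : Prop :=
  P^T = P /\ forall v : 'cV[R]_n, v != 0 -> 0 < (v^T *m P *m v) 0 0.

Section Delay.
Variables (R : realType) (Delta : R) (n : nat).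
Local Notation E := 'cV[R]_n.

(* Histories are total functions R -> E of which only the restriction to
   [-Delta, 0] is meaningful. Functionals on histories are only ever
   constrained on [history], and those satisfying [lipschitz_on_bounded]
   depend on that restriction alone, since [hnorm] does. *)
Definition history : set (R -> E) :=
  [set phi | {within `[- Delta, 0], continuous phi}].

(* The supremum is attained when [history phi] and 0 <= Delta. *)
Definition hnorm (phi : R -> E) : R :=
  sup [set enorm (phi tau) | tau in `[- Delta, 0]].

Definition lipschitz_on_bounded (U : zmodType) (N : U -> R)
    (F : (R -> E) -> U) : Prop :=
  forall A : set (R -> E), A `<=` history ->
    (exists r : R, forall phi, A phi -> hnorm phi <= r) ->
    exists L : R, forall phi psi, A phi -> A psi ->
      N (F phi - F psi) <= L * hnorm (phi \- psi).

(* x_t *)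
Definition hist_at (x : R -> E) (t : R) : R -> E := fun tau => x (t + tau).

(* phi_{h,w}; this formula also covers Delta = 0, where the only relevant
   argument is s = 0. *)
Definition driver_shift (phi : R -> E) (w : E) (h : R) : R -> E :=
  fun s => if s < - h then phi (s + h) else phi 0 + (h + s) *: w.

(* Extended-real valued: the limsup may be infinite. *)
Definition driver (V : (R -> E) -> R) (phi : R -> E) (w : E) : \bar R :=
  limf_esup (fun h => ((V (driver_shift phi w h) - V phi) / h)%:E) 0^'+.

(* x solves x'(t) = f0 (x_t) on [0, T), with x_0 as initial history; at t = 0
   the derivative is the right one. *)
Definition is_solution (f0 : (R -> E) -> E) (x0 x : R -> E) (T : \bar R) :
    Prop :=
  [/\ (0 < T)%E,
      {within [set t | - Delta <= t /\ (t%:E < T)%E], continuous x},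
      (forall tau, - Delta <= tau <= 0 -> x tau = x0 tau),
      (forall t, 0 < t -> (t%:E < T)%E ->
         is_derive t 1 x (f0 (hist_at x t))) &
      h^-1 *: (x h - x 0) @[h --> 0^'+] --> f0 (hist_at x 0)].

(* The unique maximal solution: every solution from x0 is a restriction of
   it. *)
Definition is_maximal_solution (f0 : (R -> E) -> E) (x0 x : R -> E)
    (T : \bar R) : Prop :=
  is_solution f0 x0 x T /\
  forall (y : R -> E) (S : \bar R), is_solution f0 x0 y S ->
    (S <= T)%E /\ forall t, - Delta <= t -> (t%:E < S)%E -> y t = x t.

Definition GES (f0 : (R -> E) -> E) : Prop :=
  exists k eta : R, [/\ 0 < k, 0 < eta &
    forall x0, history x0 ->
      exists2 x, is_maximal_solution f0 x0 x +oo%E &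
        forall t, 0 <= t -> enorm (x t) <= k * hnorm x0 * expR (- eta * t)].

End Delay.

(* Main.v *)
Require Import Defs.
From HB Require Import structures.
From mathcomp Require Import all_boot all_order all_algebra.
From mathcomp Require Import all_classical all_reals all_analysis.
From mathcomp Require Import ring lra.
Set Implicit Arguments.
Unset Strict Implicit.
Unset Printing Implicit Defensive.
Import Order.TTheory GRing.Theory Num.Theory numFieldNormedType.Exports.
Local Open Scope classical_set_scope.
Local Open Scope ring_scope.

(* The decay estimate is elementary.  Let K = 1 + ahi / alo and, for a solution
   x starting at time p, X = |x_p|^2.  If m is the maximum of |x|^2 on
   [p - Delta, p + T] and c T <= alo / 2, integrating the dissipation inequality
   gives m <= K X + m / 2, so |x|^2 <= 2 K X.  Cut [p, p + T] into N blocks of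
   length Delta + delta.  If |x|^2 <= eps X on the initial segment of length
   Delta of some block, with eps = 1 / (8 K), the growth bound restarted there
   gives |x_{p+T}|^2 <= X / 4.  Otherwise each block contains a time at which
   |x|^2 > eps X; as x^T P x decreases at rate at most 4 sigma K X, |x|^2 stays
   above q X for a further time delta, so V drops by at least a q delta X per
   block, up to the c-term.  For N large this contradicts V >= 0.  Thus |x_t|
   halves over each time span T, which does not depend on f0, V and c, and
   cbar = alo / (2 T) works.  Only one-sided Dini inequalities are integrated.

   For existence, f0 is composed with a coordinatewise truncation at a level
   above the a priori bound; the resulting globally Lipschitz equation is solved
   by Picard iteration in a norm with exponential weight, and the a priori bound
   keeps the solution below the truncation level. *)

(** * Euclidean norm and quadratic forms *)

Section EuclideanNorm.
Variables (R : realType) (n : nat).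
Implicit Types (u v w : 'cV[R]_n) (P : 'M[R]_n).

Lemma enorm_ge0 v : 0 <= enorm v.
Proof. exact: sqrtr_ge0. Qed.

Lemma enorm_sqr v : enorm v ^+ 2 = \sum_(i < n) v i 0 ^+ 2.
Proof. by rewrite sqr_sqrtr// sumr_ge0// => i _; exact: sqr_ge0. Qed.

Lemma enorm_dot v : enorm v ^+ 2 = (v^T *m v) 0 0.
Proof. by rewrite enorm_sqr mxE; apply: eq_bigr => i _; rewrite mxE. Qed.

Lemma enorm0 : enorm (0 : 'cV[R]_n) = 0.
Proof.
by rewrite /enorm big1 ?sqrtr0// => i _; rewrite mxE expr0n.
Qed.

Lemma coord_le_enorm v i : `|v i 0| <= enorm v.
Proof.
rewrite -sqrtr_sqr ler_sqrt; last by rewrite sumr_ge0// => j _; exact: sqr_ge0.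
by rewrite (bigD1 i)//= lerDl sumr_ge0// => j _; exact: sqr_ge0.
Qed.

Lemma enorm_eq0 v : enorm v = 0 -> v = 0.
Proof.
move=> v0; apply/colP => i; rewrite mxE; apply/eqP.
by rewrite -normr_le0 -v0 coord_le_enorm.
Qed.

Lemma enormZ (k : R) v : enorm (k *: v) = `|k| * enorm v.
Proof.
rewrite /enorm -sqrtr_sqr -sqrtrM ?sqr_ge0// mulr_sumr.
by congr Num.sqrt; apply: eq_bigr => i _; rewrite mxE exprMn.
Qed.

Lemma enormN v : enorm (- v) = enorm v.
Proof. by rewrite -scaleN1r enormZ normrN1 mul1r. Qed.

Lemma enormB v w : enorm (v - w) = enorm (w - v).
Proof. by rewrite -enormN opprB. Qed.

(** Cauchy-Schwarz: for nonzero [u] and [v] of norms [p] and [q], expand [0 <= |q u - p v|^2] and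
    divide by [2 p q]. *)
Lemma dot_le_enorm u v : \sum_(i < n) u i 0 * v i 0 <= enorm u * enorm v.
Proof.
have [->|un0] := eqVneq u 0.
  by rewrite enorm0 mul0r big1// => i _; rewrite mxE mul0r.
have [->|vn0] := eqVneq v 0.
  by rewrite enorm0 mulr0 big1// => i _; rewrite mxE mulr0.
have p0 : 0 < enorm u.
  by rewrite lt_neqAle enorm_ge0 andbT eq_sym; apply: contra_neq un0 => /enorm_eq0.
have q0 : 0 < enorm v.
  by rewrite lt_neqAle enorm_ge0 andbT eq_sym; apply: contra_neq vn0 => /enorm_eq0.
set p := enorm u in p0 *; set q := enorm v in q0 *.
have : 0 <= \sum_(i < n) (q * u i 0 - p * v i 0) ^+ 2.
  by apply: sumr_ge0 => i _; exact: sqr_ge0.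
have -> : \sum_(i < n) (q * u i 0 - p * v i 0) ^+ 2 =
    q ^+ 2 * \sum_(i < n) u i 0 ^+ 2 + p ^+ 2 * \sum_(i < n) v i 0 ^+ 2
    - 2 * p * q * \sum_(i < n) u i 0 * v i 0.
  rewrite !mulr_sumr -big_split -sumrB /=.
  by apply: eq_bigr => i _; ring.
rewrite -!enorm_sqr -/p -/q => h.
have : 0 <= 2 * p * q * (p * q - \sum_(i < n) u i 0 * v i 0).
  by apply: le_trans h _; rewrite le_eqVlt; apply/orP; left; apply/eqP; ring.
by rewrite pmulr_rge0 ?subr_ge0// !mulr_gt0.
Qed.

Lemma enormD u v : enorm (u + v) <= enorm u + enorm v.
Proof.
rewrite -(@ler_pXn2r _ 2) ?nnegrE ?addr_ge0 ?enorm_ge0//.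
rewrite sqrrD enorm_sqr.
have -> : \sum_(i < n) (u + v) i 0 ^+ 2 =
    \sum_(i < n) u i 0 ^+ 2 + (\sum_(i < n) u i 0 * v i 0) *+ 2
    + \sum_(i < n) v i 0 ^+ 2.
  rewrite -sumrMnl -!big_split /=; apply: eq_bigr => i _.
  by rewrite !mxE sqrrD.
by rewrite -!enorm_sqr lerD2r lerD2l lerMn2r/= dot_le_enorm.
Qed.

Lemma enorm_sub_le u v : `|enorm u - enorm v| <= enorm (u - v).
Proof.
have := enormD (u - v) v; have := enormD (v - u) u.
rewrite !subrK (enormB v u) => h1 h2; rewrite ler_norml; apply/andP; split; lra.
Qed.

Lemma enorm_le_coord v (M : R) : (forall i, `|v i 0| <= M) -> enorm v <= n%:R * M.
Proof.
move=> vM.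
have -> : v = \sum_(i < n) v i 0 *: delta_mx i 0.
  apply/colP => j; rewrite summxE (bigD1 j)//= !mxE !eqxx mulr1 big1 ?addr0//.
  by move=> i ij; rewrite !mxE eq_sym (negbTE ij) mulr0.
have e1 (i : 'I_n) : enorm (delta_mx i 0 : 'cV[R]_n) = 1.
  rewrite /enorm (bigD1 i)//= mxE !eqxx expr1n big1 ?addr0 ?sqrtr1//.
  by move=> j ji; rewrite mxE (negbTE ji) expr0n.
apply: (@le_trans _ _ (\sum_(i < n) M)); last first.
  by rewrite sumr_const card_ord mulr_natl.
elim/big_ind2 : _ => [|x1 x2 y1 y2 h1 h2|i _].
- by rewrite enorm0.
- by apply: le_trans (enormD _ _) _; exact: lerD.
- by rewrite enormZ e1 mulr1 vM.
Qed.

Lemma norm_le_enorm v : `|v| <= enorm v.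
Proof.
rewrite /Num.Def.normr/= mx_normrE; apply: bigmax_le => [|[i j] _/=].
  exact: enorm_ge0.
by rewrite (ord1 j) coord_le_enorm.
Qed.

Lemma enorm_le_norm v : enorm v <= n%:R * `|v|.
Proof.
apply: enorm_le_coord => i.
rewrite [leRHS]/Num.Def.normr/= mx_normrE.
exact: (le_bigmax _ (fun ij : 'I_n * 'I_1 => `|v ij.1 ij.2|) (i, 0)).
Qed.

(** Bridge between the topology of the max norm and Euclidean estimates: the two norms are
    equivalent, with factors 1 and [n]. *)
Lemma cvg_enorm {T : Type} (F : set_system T) {FF : Filter F}
    (f : T -> 'cV[R]_n) (l : 'cV[R]_n) :
  f @ F --> l <->
  (forall e, 0 < e -> \forall t \near F, enorm (f t - l) <= e).
Proof.
split=> [/cvgrPdist_le fl e e0|fl].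
  have e0' : 0 < e / n.+1%:R by rewrite divr_gt0.
  apply: filterS (fl _ e0') => t le_t.
  rewrite enormB (le_trans (enorm_le_norm _))//.
  rewrite (le_trans (ler_wpM2l (ler0n _ _) le_t))//.
  by rewrite mulrCA ler_piMr ?(ltW e0)// ler_pdivrMr// mul1r ler_nat.
apply/cvgrPdist_le => e e0; apply: filterS (fl _ e0) => t.
by rewrite enormB; apply: le_trans; exact: norm_le_enorm.
Qed.

Lemma bilin_le P : exists2 C : R, 0 < C &
  forall u v, `|(u^T *m P *m v) 0 0| <= C * (enorm u * enorm v).
Proof.
exists (1 + \sum_(i < n) \sum_(j < n) `|P i j|) => [|u v].
  by rewrite ltr_pwDl// !sumr_ge0// => i _; rewrite sumr_ge0.
apply: (@le_trans _ _
    ((\sum_(i < n) \sum_(j < n) `|P i j|) * (enorm u * enorm v))); last first.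
  by rewrite ler_wpM2r ?mulr_ge0 ?enorm_ge0// lerDr.
rewrite mxE (eq_bigr (fun j => \sum_(i < n) u i 0 * P i j * v j 0)); last first.
  by move=> j _; rewrite mxE mulr_suml; apply: eq_bigr => i _; rewrite mxE.
rewrite exchange_big /= mulr_suml (le_trans (ler_norm_sum _ _ _))//.
rewrite ler_sum// => i _.
rewrite mulr_suml (le_trans (ler_norm_sum _ _ _))//; apply: ler_sum => j _.
rewrite !normrM mulrAC mulrC ler_wpM2l//.
by rewrite ler_pM ?coord_le_enorm.
Qed.

(* Expand [0 <= W (v - s *: invmx P *m v)], where [W] is the quadratic form of
   [P], and choose [s] so as to make the two correction terms comparable. *)
Lemma posdef_lower_bound P : posdef P -> exists2 l : R, 0 < l &
  forall v, l * enorm v ^+ 2 <= (v^T *m P *m v) 0 0.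
Proof.
move=> [PT Ppos].
have Pge0 v : 0 <= (v^T *m P *m v) 0 0.
  have [->|/Ppos/ltW//] := eqVneq v 0; by rewrite mulmx0 mxE.
have Pu : P \in unitmx.
  rewrite -row_free_unit -kermx_eq0; apply/negPn/negP => /rowV0Pn[r].
  move=> /sub_kermxP rP rn0.
  have /Ppos : r^T != 0 by rewrite trmx_eq0.
  by rewrite trmxK rP mul0mx mxE ltxx.
have [C C0 PC] := bilin_le (invmx P).
(* With [u = P^-1 v], the form of [P] at [v - u / C] is [v^T P v - 2 |v|^2 / C + v^T P^-1 v / C^2],
   and the last term is at most [|v|^2 / C]. *)
exists C^-1 => [|v]; first by rewrite invr_gt0.
have := Pge0 (v - C^-1 *: (invmx P *m v)).
set u := invmx P *m v.
have Pu' : P *m u = v by rewrite mulKVmx.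
have uP : u^T *m P = v^T by rewrite -{1}PT -trmx_mul Pu'.
have -> : (v - C^-1 *: u)^T *m P *m (v - C^-1 *: u) =
    v^T *m P *m v - C^-1 *: (v^T *m v)
    - (C^-1 *: (v^T *m v) - C^-1 *: (C^-1 *: (v^T *m invmx P *m v))).
  rewrite mulmxBr !linearB/= !mulmxBl -!scalemxAr !linearZ/= -!scalemxAl uP.
  by rewrite -(mulmxA _ P u) Pu' -(mulmxA _ (invmx P)) -/u !scalerN opprD !opprK.
set A := v^T *m P *m v; set B := v^T *m v; set D := v^T *m invmx P *m v.
have Bv : B 0 0 = enorm v ^+ 2 by rewrite enorm_dot.
have /ler_normlP[_] : `|D 0 0| <= C * (enorm v * enorm v) by exact: PC.
clearbody A B D; rewrite -expr2 !mxE Bv => DC h0.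
have : C^-1 * (C^-1 * D 0 0) <= C^-1 * enorm v ^+ 2.
  rewrite ler_wpM2l ?invr_ge0 ?(ltW C0)//.
  by rewrite (mulrC C^-1) ler_pdivrMr// mulrC.
lra.
Qed.

End EuclideanNorm.

(** * Real induction, Dini derivatives and histories *)

Section RealInduction.
Variable R : realType.

(** Let [c] be the supremum of the [t] such that [P] holds on [[a, t]]. The left-limit hypothesis
    gives [P c], and the right-step hypothesis would lead past [c] if [c < b]. Several arguments
    below use this in place of compactness of [[a, b]]. *)
Lemma real_induction (a b : R) (P : R -> Prop) : P a ->
  (forall t, a <= t < b -> (forall s, a <= s <= t -> P s) ->
     exists2 d, 0 < d & forall s, t < s < t + d -> s <= b -> P s) ->
  (forall t, a < t <= b -> (forall s, a <= s < t -> P s) -> P t) ->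
  forall t, a <= t <= b -> P t.
Proof.
move=> Pa Pright Pleft t0 /andP[at0 t0b].
have ab := le_trans at0 t0b.
pose S := [set t | a <= t <= b /\ forall s, a <= s <= t -> P s].
have Sa : S a.
  split=> [|s]; first by rewrite lexx.
  by rewrite -eq_le => /eqP <-.
have supS : has_sup S.
  by split; [exists a|exists b => t [/andP[]]].
pose c := sup S.
have ac : a <= c by exact: ub_le_sup supS.2 _ Sa.
have cb : c <= b by apply: ge_sup supS.1 _ => t [/andP[]].
have Plt s : a <= s < c -> P s.
  move=> /andP[as_ sc].
  have [t [_ Pt] st] := sup_adherent (ltac:(by rewrite subr_gt0) : 0 < c - s) supS.
  by apply: Pt; rewrite as_/= ltW// (le_lt_trans _ st)// opprB addrC subrK.
have Pc : P c.
  have [<-//|ac'] := eqVneq a c.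
  by apply: Pleft => //; rewrite lt_neqAle ac' ac.
have Ple s : a <= s <= c -> P s.
  move=> /andP[as_]; rewrite le_eqVlt => /orP[/eqP->//|sc].
  by apply: Plt; rewrite as_.
have [cb'|bc] := ltP c b; last first.
  by apply: Ple; rewrite at0 (le_trans t0b).
have [|d d0 dP] := Pright c _ Ple; first by rewrite ac.
pose m := Num.min b (c + d / 2).
have cm : c < m by rewrite lt_min cb' ltrDl divr_gt0.
have Sm : S m.
  split=> [|s /andP[as_ sm]].
    by rewrite (le_trans ac (ltW cm))/= ge_min lexx.
  have [sc|cs] := leP s c; first by apply: Ple; rewrite as_.
  move: sm; rewrite le_min => /andP[sb sm]; apply: dP => //.
  rewrite cs/= (le_lt_trans sm)// ltrD2l; lra.
have := ub_le_sup supS.2 Sm; rewrite -/c; lra.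
Qed.

Lemma continuous_at_dist (v : R -> R) (t : R) : {for t, continuous v} ->
  forall e, 0 < e ->
  exists2 d, 0 < d & forall s, `|s - t| < d -> `|v s - v t| < e.
Proof.
move=> /cvgrPdist_lt vt e /vt /nbhs_ballP[d/= d0 dv].
by exists d => // s st; rewrite distrC; apply: dv; rewrite /ball/= distrC.
Qed.

(** The bound with slope [beta + e] is propagated by real induction: the Dini estimate carries it to
    the right, continuity of [v] carries it to left limits. Then [e] tends to 0. *)
Lemma dini_le (v : R -> R) (a b beta : R) : a <= b -> continuous v ->
  (forall t, a <= t < b -> forall e, 0 < e ->
    exists2 d, 0 < d &
      forall h, 0 < h < d -> v (t + h) - v t <= (beta + e) * h) ->
  v b - v a <= beta * (b - a).
Proof.
move=> ab cv Dv.
suff H e : 0 < e -> v b - v a <= (beta + e) * (b - a).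
  apply/ler_addgt0Pr => e e0.
  (* The divisor [b - a + 1] is positive even if [a = b]. *)
  have k0 : 0 < b - a + 1 by lra.
  apply: (le_trans (H (e / (b - a + 1)) _)); first by rewrite divr_gt0.
  rewrite mulrDl lerD2l mulrAC ler_pdivrMr// ler_pM2l//; lra.
move=> e0.
apply: (real_induction (P := fun t => v t - v a <= (beta + e) * (t - a))
  (b := b) (a := a)); last by rewrite ab lexx.
- by rewrite !subrr mulr0.
- move=> t atb Pt; have [d d0 dv] := Dv t atb e e0.
  exists d => // s /andP[ts sd] sb.
  have := dv (s - t); rewrite (addrC t) subrK subr_gt0 ts ltrBlDl sd => /(_ isT).
  have := Pt t; rewrite lexx (andP atb).1 => /(_ isT).
  rewrite !mulrBr; lra.
- move=> t /andP[at_ tb] Ps; rewrite leNgt; apply/negP => Pt.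
  (* [g] is the supposed excess at [t]. A point [s < t] is taken so close that [v] moves by less
     than [g / 2] and the linear bound by at most [g / 2]; the bound at [s] then gives [g < g]. *)
  pose g := v t - v a - (beta + e) * (t - a).
  have g0 : 0 < g by rewrite subr_gt0.
  have g2 : 0 < g / 2 by rewrite divr_gt0.
  have [d d0 dv] := continuous_at_dist (cv t) g2.
  pose k := `|beta + e| + 1.
  have k0 : 0 < k by rewrite ltr_wpDl.
  pose s := Num.max a (Num.max (t - d / 2) (t - g / (2 * k))).
  have st : s < t.
    by rewrite !gt_max at_ !gtrDl !oppr_lt0 !divr_gt0// mulr_gt0.
  have as_ : a <= s by rewrite le_max lexx.
  have sd : `|s - t| < d.
    rewrite ltr0_norm ?subr_lt0//.
    have : t - d / 2 <= s by rewrite !le_max lexx orbT.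
    lra.
  have sg : k * (t - s) <= g / 2.
    have : t - g / (2 * k) <= s by rewrite !le_max lexx !orbT.
    rewrite lerBlDr -lerBlDl => h.
    have -> : g / 2 = k * (g / (2 * k)) by field; rewrite gt_eqF.
    by rewrite ler_pM2l.
  have := Ps s; rewrite as_ st => /(_ isT).
  have := dv s sd; rewrite ltr_norml => /andP[h1 h2].
  have : - ((beta + e) * (t - s)) <= k * (t - s).
    rewrite -mulNr ler_pM2r ?subr_gt0//.
    by rewrite (le_trans (ler_norm _))// normrN lerDl.
  move: g0 h1 sg; rewrite /g !mulrBr; lra.
Qed.

End RealInduction.

(** * Continuous curves, their extension by clamping, and the history norm *)

Section Histories.
Variables (R : realType) (n : nat).
Local Notation E := 'cV[R]_n.
Implicit Types (x : R -> E) (phi psi : R -> E).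

Lemma continuous_enorm x t e : continuous x -> 0 < e ->
  exists2 d, 0 < d & forall s, `|s - t| < d -> enorm (x s - x t) <= e.
Proof.
move=> /(_ t) /cvg_enorm xt /xt /nbhs_ballP[d/= d0 dx].
by exists d => // s st; apply: dx; rewrite /ball/= distrC.
Qed.

Lemma enorm_continuous x :
  (forall t e, 0 < e ->
    exists2 d, 0 < d & forall s, `|s - t| < d -> enorm (x s - x t) <= e) ->
  continuous x.
Proof.
move=> H t; apply/cvg_enorm => e /(H t)[d d0 dx].
by apply/nbhs_ballP; exists d => // s; rewrite /ball/= distrC => /dx.
Qed.

Lemma continuous_bounded x a b : continuous x -> exists2 M : R, 0 <= M &
  forall t, a <= t <= b -> enorm (x t) <= M.
Proof.
move=> cx; have [ab|ba] := leP a b; last first.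
  exists 0 => // t /andP[at_ tb].
  by move: ba; rewrite ltNge (le_trans at_).
suff [M MP] : exists M, forall s, a <= s <= b -> enorm (x s) <= M.
  exists M => //.
  by rewrite (le_trans (enorm_ge0 _) (MP a _))// lexx.
apply: (real_induction (a := a) (b := b)
  (P := fun t => exists M, forall s, a <= s <= t -> enorm (x s) <= M));
  last by rewrite ab lexx.
- by exists (enorm (x a)) => s; rewrite -eq_le => /eqP->.
- move=> t /andP[at_ tb] /(_ t); rewrite at_ lexx => /(_ isT)[M MP].
  have [d d0 dx] := continuous_enorm t cx ltr01.
  exists d => // s /andP[ts std] sb.
  exists (Num.max M (enorm (x t) + 1)) => u /andP[au us].
  rewrite le_max; have [ut|tu] := leP u t.
    by rewrite MP// au ut.
  have := dx u; rewrite ger0_norm; last by lra.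
  rewrite ltrBlDl (le_lt_trans us std) => /(_ isT) h.
  apply/orP; right; rewrite -lerBlDl (le_trans _ h)//.
  by rewrite (le_trans _ (enorm_sub_le _ _))// ler_norm.
- move=> t /andP[at_ tb] Ps.
  have [d d0 dx] := continuous_enorm t cx ltr01.
  pose s := Num.max a (t - d / 2).
  have st : s < t by rewrite gt_max at_/= gtrDl oppr_lt0 divr_gt0.
  have as_ : a <= s by rewrite le_max lexx.
  have sd : t - d / 2 <= s by rewrite le_max lexx orbT.
  have [|M MP] := Ps s; first by rewrite as_.
  exists (Num.max M (enorm (x t) + 1)) => u /andP[au ut].
  rewrite le_max; have [us|su] := leP u s.
    by rewrite MP// au us.
  have := dx u; rewrite ler0_norm; last by lra.
  move=> /(_ ltac:(lra)) h.
  apply/orP; right; rewrite -lerBlDl (le_trans _ h)//.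
  by rewrite (le_trans _ (enorm_sub_le _ _))// ler_norm.
Qed.

(** Real induction on [t], the claim being a common radius on [[a, t]]; radii are glued by taking
    minima. The point [t + h] may leave [[a, b]]. *)
Lemma continuous_unif x a b e : continuous x -> 0 < e ->
  exists2 d, 0 < d & forall t h, a <= t <= b -> `|h| < d ->
    enorm (x (t + h) - x t) <= e.
Proof.
move=> cx e0; have [ab|ba] := leP a b; last first.
  exists 1 => // t h /andP[at_ tb].
  by move: ba; rewrite ltNge (le_trans at_).
have loc t : exists2 d, 0 < d & forall s h, `|s - t| < d -> `|h| < d ->
    enorm (x (s + h) - x s) <= e.
  have e2 : 0 < e / 2 by rewrite divr_gt0.
  have [d d0 dx] := continuous_enorm t cx e2.
  exists (d / 2) => [|s h st hd]; first by rewrite divr_gt0.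
  have -> : x (s + h) - x s = (x (s + h) - x t) - (x s - x t).
    by rewrite opprB addrA subrK.
  rewrite (le_trans (enormD _ _))// enormN (splitr e) lerD// dx//.
    by rewrite addrAC (le_lt_trans (ler_normD _ _))// (splitr d) ltrD.
  by lra.
apply: (real_induction (a := a) (b := b)
  (P := fun t => exists2 d, 0 < d & forall s h, a <= s <= t -> `|h| < d ->
    enorm (x (s + h) - x s) <= e)); last by rewrite ab lexx.
- have [d d0 dP] := loc a; exists d => // s h; rewrite -eq_le => /eqP <-.
  by apply: dP; rewrite subrr normr0.
- move=> t /andP[at_ tb] /(_ t); rewrite at_ lexx => /(_ isT)[d1 d10 dP1].
  have [d d0 dP] := loc t.
  exists d => // s /andP[ts std] sb.
  exists (Num.min d d1) => [|u h /andP[au us]]; first by rewrite lt_min d0.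
  rewrite lt_min => /andP[hd hd1]; have [ut|tu] := leP u t.
    by apply: dP1; rewrite // au.
  by apply: dP => //; rewrite ger0_norm; lra.
- move=> t /andP[at_ tb] Ps.
  have [d d0 dP] := loc t.
  pose s := Num.max a (t - d / 2).
  have st : s < t by rewrite gt_max at_/= gtrDl oppr_lt0 divr_gt0.
  have as_ : a <= s by rewrite le_max lexx.
  have sd : t - d / 2 <= s by rewrite le_max lexx orbT.
  have [|d1 d10 dP1] := Ps s; first by rewrite as_.
  exists (Num.min d d1) => [|u h /andP[au ut]]; first by rewrite lt_min d0.
  rewrite lt_min => /andP[hd hd1]; have [us|su] := leP u s.
    by apply: dP1; rewrite // au.
  by apply: dP => //; rewrite ler0_norm; lra.
Qed.

(** For [a <= b], the projection of the line onto [[a, b]]. In time it extends a curve from a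
    segment to a globally continuous one; in space it truncates coordinates. *)
Definition clamp (a b t : R) : R := Num.max a (Num.min b t).

Lemma clamp_itv a b t : a <= b -> a <= clamp a b t <= b.
Proof. by move=> ab; rewrite /clamp le_max lexx ge_max ab ge_min lexx. Qed.

Lemma clamp_id a b t : a <= t <= b -> clamp a b t = t.
Proof. by move=> /andP[at_ tb]; rewrite /clamp min_r// max_r. Qed.

Lemma clamp_dist a b s t : `|clamp a b s - clamp a b t| <= `|s - t|.
Proof.
wlog st : s t / s <= t.
  move=> H; have [|/ltW ts] := leP s t; first exact: H.
  by rewrite distrC (distrC s); exact: H.
rewrite distrC (distrC s) !ger0_norm ?subr_ge0//; last first.
  by rewrite le_max2 ?lexx// le_min2.
rewrite lerBlDr /clamp ge_max; apply/andP; split.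
  by rewrite -[leLHS]add0r lerD ?subr_ge0// le_max lexx.
have [bs|sb] := leP b s.
  rewrite (min_l (le_trans bs st)) -[leLHS]add0r lerD ?subr_ge0//.
  by rewrite le_max lexx orbT.
rewrite ge_min; apply/orP; right.
by rewrite -lerBlDl opprB addrC subrK le_max lexx orbT.
Qed.

Lemma continuous_clamp a b x (A : set R) : a <= b -> `[a, b] `<=` A ->
  {within A, continuous x} -> continuous (fun t => x (clamp a b t)).
Proof.
move=> ab abA /subspace_continuousP cx; apply: enorm_continuous => t e e0.
have Act : A (clamp a b t) by apply: abA; rewrite /= in_itv/= clamp_itv.
have /cvg_enorm/(_ e e0) := cx _ Act.
move=> /nbhs_ballP[d/= d0 dx]; exists d => // s st.
apply: dx; last by apply: abA; rewrite /= in_itv/= clamp_itv.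
by rewrite /ball/= (le_lt_trans _ st)// distrC clamp_dist.
Qed.

Variable Delta : R.
Hypothesis Delta0 : 0 <= Delta.

Local Notation history := (@history R Delta n).
Local Notation hnorm := (@hnorm R Delta n).

Lemma history_hist_at x t : continuous x -> history (hist_at x t).
Proof.
move=> cx; apply: continuous_subspaceT => s.
apply: (@continuous_comp _ _ _ (fun u => t + u) x); last exact: cx.
by apply: cvgD; [exact: cvg_cst|exact: cvg_id].
Qed.

(** The supremum dominates the set once the set is known to be bounded, which comes from the
    clamped, globally continuous extension of [phi]. *)
Lemma hnorm_ub phi tau : history phi -> - Delta <= tau <= 0 ->
  enorm (phi tau) <= hnorm phi.
Proof.
move=> hphi tauD; apply: ub_le_sup; last by exists tau; rewrite //= in_itv.
have D0 : - Delta <= 0 by rewrite oppr_le0.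
have [M _ MP] :=
  continuous_bounded (- Delta) 0 (continuous_clamp D0 (@subset_refl _ _) hphi).
exists M => _ [s + <-]; rewrite /= in_itv/= => sD.
by have := MP s sD; rewrite clamp_id.
Qed.

Lemma hnorm_le phi (r : R) :
  (forall tau, - Delta <= tau <= 0 -> enorm (phi tau) <= r) -> hnorm phi <= r.
Proof.
move=> phir; apply: ge_sup.
  by exists (enorm (phi 0)); exists 0; rewrite //= in_itv/= lexx oppr_le0 Delta0.
by move=> _ [s + <-]; rewrite /= in_itv/=; exact: phir.
Qed.

Lemma hnorm_ge0 phi : history phi -> 0 <= hnorm phi.
Proof.
move=> hphi; rewrite (le_trans (enorm_ge0 (phi 0)))// hnorm_ub//.
by rewrite lexx oppr_le0 Delta0.
Qed.

Lemma hnorm_ext phi psi :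
  (forall tau, - Delta <= tau <= 0 -> phi tau = psi tau) ->
  hnorm phi = hnorm psi.
Proof.
move=> pp; congr sup; apply/seteqP; split=> _ [s sD <-]; exists s => //.
  by rewrite pp//; move: sD; rewrite /= in_itv.
by rewrite pp//; move: sD; rewrite /= in_itv.
Qed.

Lemma historyB phi psi : history phi -> history psi -> history (phi \- psi).
Proof. by move=> h1 h2; exact: within_continuousB. Qed.

Lemma hist_at_continuous x t e : continuous x -> 0 < e ->
  exists2 d, 0 < d & forall s, `|s - t| < d ->
    hnorm (hist_at x s \- hist_at x t) <= e.
Proof.
move=> cx e0; have [d d0 dx] := continuous_unif (t - Delta) t cx e0.
exists d => // s st; apply: hnorm_le => tau /andP[h1 h2].
rewrite /hist_at/=; have -> : s + tau = (t + tau) + (s - t) by ring.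
by apply: dx => //; apply/andP; split; lra.
Qed.

Lemma hist_at_bounded x a b : continuous x -> exists2 M : R, 0 <= M &
  forall t, a <= t <= b -> hnorm (hist_at x t) <= M.
Proof.
move=> cx; have [M M0 MP] := continuous_bounded (a - Delta) b cx.
exists M => // t /andP[at_ tb]; apply: hnorm_le => tau /andP[h1 h2].
by apply: MP; apply/andP; split; lra.
Qed.

Lemma lipschitz_ball (U : zmodType) (N : U -> R) (F : (R -> E) -> U) (r : R) :
  lipschitz_on_bounded Delta N F -> exists2 L, 0 < L & forall phi psi,
    history phi -> history psi -> hnorm phi <= r -> hnorm psi <= r ->
    N (F phi - F psi) <= L * hnorm (phi \- psi).
Proof.
move=> /(_ [set phi | history phi /\ hnorm phi <= r])[||L LP].
- by move=> ? [].
- by exists r => ? [].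
(* This makes the constant positive, so that later steps may divide by it. *)
exists (`|L| + 1) => [|phi psi h1 h2 r1 r2]; first by rewrite ltr_wpDl.
apply: le_trans (LP phi psi _ _) _; rewrite //= ler_wpM2r//.
  exact/hnorm_ge0/historyB.
by rewrite (le_trans (ler_norm _))// lerDl.
Qed.

Lemma functional_continuous (U : zmodType) (N : U -> R) (F : (R -> E) -> U)
    x (t e : R) :
  lipschitz_on_bounded Delta N F -> continuous x -> 0 < e ->
  exists2 d, 0 < d & forall s, `|s - t| < d ->
    N (F (hist_at x s) - F (hist_at x t)) <= e.
Proof.
move=> lF cx e0; have [M M0 MP] := hist_at_bounded (t - 1) (t + 1) cx.
have [L L0 LP] := lipschitz_ball M lF.
have [d d0 dP] := hist_at_continuous t cx (ltac:(by rewrite divr_gt0) : 0 < e / L).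
exists (Num.min d 1) => [|s]; first by rewrite lt_min d0/=.
rewrite lt_min => /andP[/dP sd s1].
have H := LP (hist_at x s) (hist_at x t) (@history_hist_at x s cx)
  (@history_hist_at x t cx).
apply: (le_trans (H (MP _ _) (MP _ _))).
- by move: s1; rewrite ltr_norml => /andP[]; lra.
- by lra.
- by rewrite mulrC -ler_pdivlMr.
Qed.

End Histories.

(** * Right derivatives and Dini inequalities along curves *)

Section DiniAlongCurves.
Variables (R : realType) (n : nat) (Delta : R).
Hypothesis Delta0 : 0 <= Delta.
Local Notation E := 'cV[R]_n.
Local Notation history := (@history R Delta n).
Local Notation hnorm := (@hnorm R Delta n).
Implicit Types (x : R -> E) (phi psi : R -> E) (w : E).

(** This error form avoids quotients; [right_derivP] equates it with the limit of the right
    difference quotient. *)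
Definition right_deriv x (t : R) w : Prop := forall e : R, 0 < e ->
  exists2 d, 0 < d &
    forall h, 0 < h < d -> enorm (x (t + h) - x t - h *: w) <= e * h.

Lemma hnorm_sqr_le phi (m : R) : history phi ->
  (forall tau, - Delta <= tau <= 0 -> enorm (phi tau) ^+ 2 <= m) ->
  hnorm phi ^+ 2 <= m.
Proof.
move=> hphi phim.
have m0 : 0 <= m.
  by rewrite (le_trans (sqr_ge0 (enorm (phi 0))))// phim// lexx oppr_le0 Delta0.
rewrite -[leRHS]sqr_sqrtr// ler_pXn2r ?nnegrE ?sqrtr_ge0 ?hnorm_ge0//.
apply: hnorm_le => // tau /phim h.
by rewrite -(ger0_norm (enorm_ge0 _)) -sqrtr_sqr ler_wsqrtr.
Qed.

Lemma hnorm_triangle phi psi : history phi -> history psi ->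
  hnorm psi <= hnorm phi + hnorm (phi \- psi).
Proof.
move=> h1 h2; apply: hnorm_le => // tau tauD.
have -> : psi tau = phi tau - (phi \- psi) tau by rewrite /= subKr.
rewrite (le_trans (enormD _ _))// enormN lerD// hnorm_ub//.
exact: historyB.
Qed.

Lemma history_driver_shift phi w h : history phi -> 0 <= h ->
  history (driver_shift phi w h).
Proof.
move=> hphi h0.
have D0 : - Delta <= 0 by rewrite oppr_le0.
(* On [[- Delta, 0]] the two branches merge into one expression: [phi] stopped at time 0 plus a ramp
   in direction [w], both continuous. *)
pose g s := phi (clamp (- Delta) 0 (s + h)) + Num.max (s + h) 0 *: w.
apply: (@subspace_eq_continuous _ _ _ (g : subspace `[- Delta, 0] -> E)).
  move=> s; rewrite inE /= in_itv/= => /andP[s1 s2].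
  rewrite /g /from_subspace /driver_shift.
  case: ifPn => [sh|]; last rewrite -leNgt => sh.
    rewrite clamp_id; last by apply/andP; split; lra.
    by rewrite max_r ?scale0r ?addr0//; lra.
  rewrite (_ : clamp _ _ _ = 0); last first.
    by rewrite /clamp min_l ?max_r//; lra.
  by rewrite max_l ?(addrC h)//; lra.
apply: continuous_subspaceT => s.
have sc : {for s, continuous (fun u : R => u + h)}.
  by apply: cvgD; [exact: cvg_id|exact: cvg_cst].
apply: cvgD.
  apply: (@continuous_comp _ _ _ (fun u : R => u + h)
    (fun u => phi (clamp (- Delta) 0 u))) => //.
  exact: (continuous_clamp D0 (@subset_refl _ _) hphi).
apply: cvgZr_tmp.
apply: (@continuous_comp _ _ _ (fun u : R => u + h) (fun u => Num.max u 0)) => //.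
apply: (@continuous_max _ _ id (fun=> 0)); first exact: cvg_id.
exact: cvg_cst.
Qed.

Lemma driver_le_dini (V : (R -> E) -> R) phi w (beta : R) :
  (driver V phi w <= beta%:E)%E -> forall e, 0 < e -> exists2 d, 0 < d &
    forall h, 0 < h < d -> V (driver_shift phi w h) - V phi <= (beta + e) * h.
Proof.
move=> Vb e e0.
have : (driver V phi w < (beta + e)%:E)%E.
  by rewrite (le_lt_trans Vb)// lte_fin ltrDl.
(* The limsup is an infimum of suprema; being strictly below [beta + e], it provides a right
   neighbourhood of 0 on which all quotients are below [beta + e]. *)
rewrite /driver limf_esupE => /ereal_inf_lt[_ [A A0 <-]] supA.
move: A0 => /nbhs_ballP[d/= d0 dA]; exists d => // h /andP[h0 hd].
have Ah : A h.
  by apply: dA; rewrite /ball/= ?sub0r ?normrN// gtr0_norm.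
rewrite -ler_pdivrMr// -lee_fin (le_trans _ (ltW supA))//.
by apply: ereal_sup_ubound; exists h.
Qed.

(** The two histories agree for [tau < - h]; on [[- h, 0]] they differ by
    [x (t + h + tau) - x t - (h + tau) *: w], which the right derivative controls. Hence the driver
    derivative governs [V] along curves. *)
Lemma driver_shift_near x t w : continuous x -> right_deriv x t w ->
  forall e : R, 0 < e -> exists2 d, 0 < d & forall h, 0 < h < d ->
    hnorm (hist_at x (t + h) \- driver_shift (hist_at x t) w h) <= e * h.
Proof.
move=> cx xw e e0; have [d d0 dx] := xw e e0.
exists d => // h /andP[h0 hd]; apply: hnorm_le => // tau /andP[tau1 tau2].
rewrite /hist_at /driver_shift /=; case: ifPn => [th|].
  rewrite (_ : t + h + tau = t + (tau + h)); last by ring.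
  by rewrite subrr enorm0 mulr_ge0// ltW.
rewrite -leNgt addr0 opprD addrA -addrA => th.
rewrite -(addrA t) addrA.
(* [right_deriv] speaks of positive increments only, so [tau = - h] is treated apart. *)
have [->|n0] := eqVneq (h + tau) 0.
  by rewrite addr0 subrr scale0r subr0 enorm0 mulr_ge0// ltW.
apply: le_trans (dx (h + tau) _) _.
  by apply/andP; split; [rewrite lt_neqAle eq_sym n0|]; lra.
by rewrite ler_pM2l//; lra.
Qed.

Section Functional.
Variable V : (R -> E) -> R.
Hypothesis Vlip : lipschitz_on_bounded Delta (fun r : R => `|r|) V.

Lemma functional_dini x t w (beta : R) : continuous x -> right_deriv x t w ->
  (driver V (hist_at x t) w <= beta%:E)%E ->
  forall e, 0 < e -> exists2 d, 0 < d & forall h, 0 < h < d ->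
    V (hist_at x (t + h)) - V (hist_at x t) <= (beta + e) * h.
Proof.
move=> cx xw Vb e e0.
have [M M0 MP] := hist_at_bounded Delta0 t (t + 1) cx.
have [L L0 LP] := lipschitz_ball Delta0 (M + 1) Vlip.
have [d1 d10 dP1] := driver_le_dini Vb (ltac:(by rewrite divr_gt0) : 0 < e / 2).
pose e2 := e / (2 * L).
have e20 : 0 < e2 by rewrite divr_gt0// mulr_gt0.
have [d2 d20 dP2] := driver_shift_near cx xw e20.
(* The tolerance 1 keeps the shifted history in the ball of radius [M + 1], on which [L] is a
   Lipschitz constant of [V]. *)
have [d3 d30 dP3] := driver_shift_near cx xw ltr01.
exists (Num.min (Num.min d1 d2) (Num.min d3 1)) => [|h].
  by rewrite !lt_min d10 d20 d30 ltr01.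
rewrite !lt_min => /andP[h0 /andP[/andP[h1 h2] /andP[h3 h4]]].
have := dP1 h; have := dP2 h; have := dP3 h; rewrite h0 h1 h2 h3.
move=> /(_ isT) q3 /(_ isT) q2 /(_ isT) q1.
have hist1 : history (hist_at x (t + h)) by exact: history_hist_at.
have hist2 : history (driver_shift (hist_at x t) w h).
  by apply: history_driver_shift; [exact: history_hist_at|exact: ltW].
have r1 : hnorm (hist_at x (t + h)) <= M.
  by apply: MP; apply/andP; split; lra.
have r2 : hnorm (driver_shift (hist_at x t) w h) <= M + 1.
  rewrite (le_trans (hnorm_triangle hist1 hist2))//; lra.
have := LP _ _ hist1 hist2 (le_trans r1 (ltac:(lra) : M <= M + 1)) r2.
move=> /(le_trans (ler_norm _)) q4.
have : L * hnorm (hist_at x (t + h) \- driver_shift (hist_at x t) w h)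
    <= e / 2 * h.
  have -> : e / 2 * h = L * (e2 * h) by rewrite /e2; field; rewrite gt_eqF.
  by rewrite ler_pM2l.
move: q1 q4; rewrite !mulrDl; lra.
Qed.

Lemma functional_le x a b (beta : R) (w : R -> E) : a <= b -> continuous x ->
  (forall t, a <= t < b -> right_deriv x t (w t)) ->
  (forall t, a <= t < b -> (driver V (hist_at x t) (w t) <= beta%:E)%E) ->
  V (hist_at x b) - V (hist_at x a) <= beta * (b - a).
Proof.
move=> ab cx xw Vb; apply: (dini_le (v := fun t => V (hist_at x t))) => //.
  move=> t; apply/cvgrPdist_le => e e0.
  have [d d0 dP] := functional_continuous Delta0 t Vlip cx e0.
  apply/nbhs_ballP; exists d => // s.
  by rewrite /ball/= distrC => /dP; rewrite distrC.
by move=> t tab e e0; apply: functional_dini (xw t tab) (Vb t tab) _ e0.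
Qed.

End Functional.

Lemma quadratic_ge (P : 'M[R]_n) x a b (beta : R) (w : R -> E) :
  posdef P -> a <= b -> continuous x ->
  (forall t, a <= t < b -> right_deriv x t (w t)) ->
  (forall t, a <= t < b -> - beta <= ((x t)^T *m P *m w t) 0 0) ->
  ((x a)^T *m P *m x a) 0 0 - 2 * beta * (b - a) <= ((x b)^T *m P *m x b) 0 0.
Proof.
move=> hP ab cx xw xPw.
pose B (u v : E) : R := (u^T *m P *m v) 0 0.
have BC u v : B u v = B v u.
  rewrite /B (_ : (u^T *m P *m v) 0 0 = (u^T *m P *m v)^T 0 0).
    by rewrite !trmx_mul trmxK hP.1 mulmxA.
  by rewrite [RHS]mxE.
have BDr u v v' : B u (v + v') = B u v + B u v' by rewrite /B mulmxDr mxE.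
have BZr u v k : B u (k *: v) = k * B u v by rewrite /B -scalemxAr mxE.
have BNr u v : B u (- v) = - B u v by rewrite /B mulmxN mxE.
have [C C0 BCle] := bilin_le P.
have W0 v : 0 <= B v v.
  have [l l0 lP] := posdef_lower_bound hP.
  by rewrite (le_trans _ (lP v))// mulr_ge0 ?sqr_ge0// ltW.
have WD u v : B (u + v) (u + v) = B u u + 2 * B u v + B v v.
  by rewrite BDr (BC _ u) (BC _ v) !BDr (BC v u); ring.
suff : - B (x b) (x b) - - B (x a) (x a) <= 2 * beta * (b - a) by rewrite /B; lra.
apply: (dini_le (v := fun t => - B (x t) (x t))) => //.
  move=> t; apply: cvgN; apply/cvgrPdist_le => e e0.
  pose k := C * (2 * enorm (x t) + 1).
  have k0 : 0 < k by rewrite mulr_gt0// ltr_wpDl// mulr_ge0// enorm_ge0.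
  have m0 : 0 < Num.min 1 (e / k) by rewrite lt_min ltr01 divr_gt0.
  have [d d0 dP] := continuous_enorm t cx m0.
  apply/nbhs_ballP; exists d => // s; rewrite /ball/= distrC => /dP.
  rewrite le_min => /andP[le1 lek]; rewrite distrC.
  have -> : x s = x t + (x s - x t) by rewrite addrC subrK.
  set v := x s - x t in le1 lek *.
  rewrite WD (_ : _ - _ = 2 * B (x t) v + B v v); last by ring.
  rewrite (le_trans (ler_normD _ _))//.
  apply: (@le_trans _ _ (k * enorm v)); last by rewrite mulrC -ler_pdivlMr.
  have h1 := BCle (x t) v; have h2 := BCle v v.
  rewrite normrM (ger0_norm (ltac:(lra) : 0 <= 2)).
  apply: (@le_trans _ _
    (2 * (C * (enorm (x t) * enorm v)) + C * (enorm v * enorm v))).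
    by rewrite lerD// ler_pM2l.
  have -> : k * enorm v = 2 * (C * (enorm (x t) * enorm v)) + C * enorm v.
    by rewrite /k; ring.
  by rewrite lerD2l ler_pM2l// ler_piMr// enorm_ge0.
move=> t tab e e0.
pose k := 2 * (C * (enorm (x t) + 1)).
have k0 : 0 < k by rewrite !mulr_gt0// ltr_wpDl// enorm_ge0.
have [d d0 dx] := xw t tab _ (divr_gt0 e0 k0).
exists d => // h hd; have := dx h hd.
move: hd => /andP[h0 hd].
set r := x (t + h) - x t - h *: w t => rle.
have -> : x (t + h) = x t + (h *: w t + r).
  by rewrite /r [h *: w t + _]addrC subrK [RHS]addrC subrK.
rewrite WD BDr BZr.
have := W0 (h *: w t + r).
have := BCle (x t) r; rewrite ler_norml => /andP[h1 _].
have : 2 * (C * (enorm (x t) * enorm r)) <= e * h.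
  apply: (@le_trans _ _ (k * enorm r)); last first.
    have -> : e * h = k * (e / k * h) by field; rewrite gt_eqF.
    by rewrite ler_pM2l.
  rewrite /k -!mulrA !ler_pM2l// ler_wpM2r ?enorm_ge0//; lra.
have : - (h * B (x t) (w t)) <= h * beta.
  by rewrite -mulrN ler_pM2l// lerNl xPw.
rewrite -/(B _ _) in h1.
clearbody B; lra.
Qed.

End DiniAlongCurves.

(** * Exponential decay of solutions *)

Section Decay.
Variables (R : realType) (n : nat) (Delta : R).
Hypothesis Delta0 : 0 <= Delta.
Local Notation E := 'cV[R]_n.
Local Notation history := (@history R Delta n).
Local Notation hnorm := (@hnorm R Delta n).
Implicit Types (x : R -> E).

(* Only right derivatives are recorded, so that solutions may be stopped,
   restricted and concatenated freely. *)
Definition solves (f : (R -> E) -> E) x (a b : R) : Prop :=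
  continuous x /\ forall t, a <= t < b -> right_deriv x t (f (hist_at x t)).

Lemma solves_sub f x (a b a' b' : R) : a <= a' -> b' <= b ->
  solves f x a b -> solves f x a' b'.
Proof.
move=> aa bb [cx xf]; split=> // t /andP[h1 h2]; apply: xf.
by apply/andP; split; lra.
Qed.

Variables (f0 : (R -> E) -> E) (V : (R -> E) -> R).
Variables (alo ahi a c sigma l1 l2 : R) (P : 'M[R]_n).
Hypotheses (halo : 0 < alo) (hahi : 0 < ahi) (ha : 0 < a) (hc : 0 <= c).
Hypotheses (hsigma : 0 < sigma) (hP : posdef P) (hl1 : 0 < l1) (hl2 : 0 < l2).
Hypothesis Pl1 : forall v : E, l1 * enorm v ^+ 2 <= (v^T *m P *m v) 0 0.
Hypothesis Pl2 : forall v : E, (v^T *m P *m v) 0 0 <= l2 * enorm v ^+ 2.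
Hypothesis Vlip : lipschitz_on_bounded Delta (fun r : R => `|r|) V.
Hypothesis V0 : forall phi, history phi -> 0 <= V phi.
Hypothesis Vbnd : forall phi, history phi ->
  alo * enorm (phi 0) ^+ 2 <= V phi <= ahi * hnorm phi ^+ 2.
Hypothesis Vdrv : forall phi, history phi ->
  (driver V phi (f0 phi) <=
     (- a * enorm (phi 0) ^+ 2 + c * hnorm phi ^+ 2)%:E)%E.
Hypothesis Pgrowth : forall phi, history phi ->
  - sigma * hnorm phi ^+ 2 <= ((phi 0)^T *m P *m f0 phi) 0 0.

Lemma enorm_hist_at x t : enorm (hist_at x t 0) = enorm (x t).
Proof. by rewrite /hist_at addr0. Qed.

Lemma hnorm_hist_at_le x (p q t m : R) : continuous x ->
  (forall s, p - Delta <= s <= q -> enorm (x s) ^+ 2 <= m) -> p <= t <= q ->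
  hnorm (hist_at x t) ^+ 2 <= m.
Proof.
move=> cx xm /andP[pt tq].
apply: (hnorm_sqr_le Delta0 (@history_hist_at _ _ Delta x t cx)).
by move=> tau /andP[h1 h2]; apply: xm; apply/andP; split; lra.
Qed.

Lemma le_hnorm_hist_at x (t s : R) : continuous x -> t - Delta <= s <= t ->
  enorm (x s) ^+ 2 <= hnorm (hist_at x t) ^+ 2.
Proof.
move=> cx /andP[h1 h2]; have hx := @history_hist_at _ _ Delta x t cx.
rewrite ler_pXn2r ?nnegrE ?enorm_ge0 ?(hnorm_ge0 Delta0 hx)//.
have -> : x s = hist_at x t (s - t) by rewrite /hist_at addrC subrK.
apply: (hnorm_ub Delta0 hx).
by apply/andP; split; lra.
Qed.

(** Used with [r = 0] to limit the growth of [V] and with [r = q * X] to obtain a drop. *)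
Lemma V_increment x (p q m r : R) : p <= q -> solves f0 x p q ->
  (forall t, p <= t < q -> hnorm (hist_at x t) ^+ 2 <= m) ->
  (forall t, p <= t < q -> r <= enorm (x t) ^+ 2) ->
  V (hist_at x q) - V (hist_at x p) <= (c * m - a * r) * (q - p).
Proof.
move=> pq [cx xf] xm xr.
apply: (functional_le Delta0 Vlip pq cx xf) => t tpq.
apply: (le_trans (Vdrv (@history_hist_at _ _ Delta x t cx))).
rewrite lee_fin enorm_hist_at addrC mulNr lerB//.
  by rewrite ler_wpM2l// xm.
by rewrite ler_pM2l// xr.
Qed.

(** The constant [K] of the overview. For [c = 0] the bounds on [V] give [ahi / alo]; the added 1
    covers the initial segment. *)
Definition gain : R := 1 + ahi / alo.

Lemma gain_gt0 : 0 < gain.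
Proof. by rewrite addr_gt0// divr_gt0. Qed.

(** A bound [m] on the window improves to [gain * X + m / 2], since the [c]-term adds at most
    [c T m <= alo m / 2] to [V]. Applied to the supremum, this bounds it by [2 * gain * X]. *)
Lemma growth_bound (T : R) x (p q : R) : p <= q -> q - p <= T -> c * T <= alo / 2 ->
  solves f0 x p q -> forall t, p - Delta <= t <= q ->
  enorm (x t) ^+ 2 <= 2 * gain * hnorm (hist_at x p) ^+ 2.
Proof.
move=> pq qpT cT xsol; have D0 := Delta0; have cx := xsol.1.
set X := hnorm (hist_at x p) ^+ 2.
have X0 : 0 <= X by exact: sqr_ge0.
have step (m : R) : (forall t, p - Delta <= t <= q -> enorm (x t) ^+ 2 <= m) ->
    forall t, p - Delta <= t <= q -> enorm (x t) ^+ 2 <= gain * X + m / 2.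
  move=> xm t /andP[t1 t2].
  have m0 : 0 <= m by rewrite (le_trans (sqr_ge0 (enorm (x t))))// xm// t1.
  have [tp|/ltW pt] := leP t p.
    rewrite (@le_trans _ _ X)//; first by rewrite le_hnorm_hist_at// t1.
    rewrite /gain mulrDl mul1r -addrA lerDl addr_ge0// ?divr_ge0// mulr_ge0//.
    by rewrite divr_ge0// ltW.
  have tpq : c * m * (t - p) <= alo * m / 2.
    apply: (@le_trans _ _ (c * m * T)).
      by rewrite ler_wpM2l// ?mulr_ge0//; lra.
    by rewrite mulrAC [leRHS]mulrAC ler_wpM2r.
  have hx := @history_hist_at _ _ Delta x t cx.
  have hxp := @history_hist_at _ _ Delta x p cx.
  have := Vbnd hx; have := Vbnd hxp.
  rewrite !enorm_hist_at -/X => /andP[_ Vp] /andP[Vt _].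
  have xsm (s : R) : p <= s < t -> hnorm (hist_at x s) ^+ 2 <= m.
    move=> /andP[s1 s2]; apply: (hnorm_hist_at_le cx xm).
    by apply/andP; split; lra.
  have := V_increment pt (solves_sub (lexx p) t2 xsol) xsm
    (fun s _ => sqr_ge0 (enorm (x s))).
  rewrite mulr0 subr0 => Vinc.
  rewrite -(ler_pM2l halo) (le_trans Vt)//.
  have -> : alo * (gain * X + m / 2) = alo * X + ahi * X + alo * m / 2.
    by rewrite /gain; field; rewrite gt_eqF.
  have := mulr_ge0 (ltW halo) X0; lra.
pose S := [set enorm (x t) ^+ 2 | t in `[p - Delta, q]].
have S0 : S !=set0.
  by exists (enorm (x p) ^+ 2); exists p => //=; rewrite in_itv/= gerBl D0.
have ubS : has_ubound S.
  have [M M0 MP] := continuous_bounded (p - Delta) q cx.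
  exists (M ^+ 2) => _ [t + <-]; rewrite /= in_itv/= => /MP.
  by rewrite ler_pXn2r ?nnegrE ?enorm_ge0.
have lesup (t : R) : p - Delta <= t <= q -> enorm (x t) ^+ 2 <= sup S.
  by move=> h; apply: ub_le_sup => //; exists t; rewrite //= in_itv.
have : sup S <= gain * X + sup S / 2.
  apply: ge_sup S0 _ => _ [t + <-]; rewrite /= in_itv/= => h.
  exact: step h.
move=> h t /lesup ht; lra.
Qed.

(** [eps] makes [2 gain eps = 1 / 4]. During a time [delta], at rate [4 sigma gain X], the form of
    [P] loses at most half of [l1 eps X], and [q X] is what the other half leaves for [|x|^2]. [N]
    makes the drops exceed [V <= ahi X] plus the total [c]-term, at most [(alo + ahi) X]. *)
Variables (eps delta q : R) (N : nat).
Hypothesis heps : eps = (8 * gain)^-1.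
Hypothesis hdelta : 0 < delta.
Hypothesis hdelta_small : 8 * sigma * gain * delta <= l1 * eps.
Hypothesis hq : q = l1 * eps / (2 * l2).
Hypothesis hN : 2 * ahi + alo < N%:R * (a * q * delta).
Local Notation T := (N%:R * (Delta + delta)).
Hypothesis cT : c * T <= alo / 2.

Let eps0 : 0 < eps.
Proof. by rewrite heps invr_gt0 mulr_gt0// gain_gt0. Qed.

Let q0 : 0 < q.
Proof. by rewrite hq divr_gt0 ?mulr_gt0. Qed.

Let N0 : (0 < N)%N.
Proof.
have := halo; have := hahi.
rewrite lt0n => ? ?; apply/eqP => N0; move: hN; rewrite N0 mul0r; lra.
Qed.

Let T0 : 0 < T.
Proof. by rewrite mulr_gt0 ?ltr0n// ltr_wpDl. Qed.

(* A value of size [sqrt (eps * X)] persists for a time [delta], during which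
   [V] has to drop by [a * q * delta * X]. *)
Lemma block_drop x (p s X : R) : 0 <= X -> p <= s <= p + Delta ->
  solves f0 x p (p + (Delta + delta)) ->
  (forall t, p - Delta <= t <= p + (Delta + delta) ->
     enorm (x t) ^+ 2 <= 2 * gain * X) ->
  eps * X < enorm (x s) ^+ 2 ->
  V (hist_at x (p + (Delta + delta))) - V (hist_at x p) <=
    (c * (2 * gain) * (Delta + delta) - a * q * delta) * X.
Proof.
move=> X0 /andP[ps sp] xsol xM xs; have cx := xsol.1.
have D0 := Delta0; have d0 := hdelta.
have xh (t : R) : p <= t <= p + (Delta + delta) ->
    hnorm (hist_at x t) ^+ 2 <= 2 * gain * X.
  exact: hnorm_hist_at_le.
have g0 := gain_gt0.
have gX0 : 0 <= gain * X by rewrite mulr_ge0// ltW.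
have low (t : R) : s <= t < s + delta -> q * X <= enorm (x t) ^+ 2.
  move=> /andP[st td].
  have xsol' : solves f0 x s t by apply: solves_sub xsol; lra.
  have xPf (u : R) : s <= u < t ->
      - (sigma * (2 * gain * X)) <= ((x u)^T *m P *m f0 (hist_at x u)) 0 0.
    move=> /andP[su ut].
    have := Pgrowth (@history_hist_at _ _ Delta x u cx).
    rewrite {2}/hist_at addr0 => h.
    apply: le_trans h; rewrite mulNr lerN2 ler_pM2l//.
    by apply: xh; apply/andP; split; lra.
  have h := quadratic_ge hP st cx xsol'.2 xPf.
  have h1 := Pl1 (x s); have h2 := Pl2 (x t).
  have h3 : l1 * (eps * X) <= l1 * enorm (x s) ^+ 2 by rewrite ler_pM2l// ltW.
  (* At most half of [l1 * eps * X] is lost; the other half, divided by [l2], is [q * X]. *)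
  have h4 : 2 * (sigma * (2 * gain * X)) * (t - s) <= l1 * eps * X / 2.
    apply: (@le_trans _ _ (2 * (sigma * (2 * gain * X)) * delta)).
      have ts : t - s <= delta by lra.
      by rewrite ler_wpM2l// !mulr_ge0// ltW.
    have := ler_wpM2r X0 hdelta_small.
    lra.
  have -> : q * X = l1 * eps * X / 2 / l2.
    by rewrite hq; field; rewrite gt_eqF.
  rewrite ler_pdivrMr// (mulrC _ l2); lra.
have hp1 : p <= s by [].
have sol1 : solves f0 x p s by apply: solves_sub xsol; lra.
have sol2 : solves f0 x s (s + delta) by apply: solves_sub xsol; lra.
have sol3 : solves f0 x (s + delta) (p + (Delta + delta)).
  by apply: solves_sub xsol; lra.
have xh' (u v t : R) : p <= u -> v <= p + (Delta + delta) -> u <= t < v ->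
    hnorm (hist_at x t) ^+ 2 <= 2 * gain * X.
  by move=> pu vp /andP[ut tv]; apply: xh; apply/andP; split; lra.
have hp2 : s + delta <= p + (Delta + delta) by lra.
have hp3 : s <= p + (Delta + delta) by lra.
have hp4 : p <= s + delta by lra.
have hp5 : s <= s + delta by lra.
(* The drop is earned on [[s, s + delta]], which fits into the block because [s <= p + Delta]; on
   the two outer pieces only the [c]-term counts. *)
have v1 := V_increment ps sol1 (fun t => xh' p s t (lexx p) hp3)
  (fun t _ => sqr_ge0 (enorm (x t))).
have v2 := V_increment hp5 sol2 (fun t => xh' s _ t ps hp2) low.
have v3 := V_increment hp2 sol3 (fun t => xh' _ _ t hp4 (lexx _))
  (fun t _ => sqr_ge0 (enorm (x t))).
lra.
Qed.

Lemma contraction x (p : R) : solves f0 x p (p + T) ->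
  hnorm (hist_at x (p + T)) ^+ 2 <= 4^-1 * hnorm (hist_at x p) ^+ 2.
Proof.
move=> xsol; have cx := xsol.1.
have D0 := Delta0; have d0 := hdelta.
set X := hnorm (hist_at x p) ^+ 2.
have X0 : 0 <= X by exact: sqr_ge0.
have g0 := gain_gt0.
have pT : p <= p + T by rewrite lerDl ltW.
have xM := growth_bound pT (ltac:(by rewrite addrC addKr) : p + T - p <= T) cT xsol.
pose b (j : nat) := p + j%:R * (Delta + delta).
have L0 : 0 < Delta + delta by rewrite ltr_wpDl.
have bS j : b j.+1 = b j + (Delta + delta).
  by rewrite /b -addn1 natrD; ring.
have bN j : (j <= N)%N -> p <= b j <= p + T.
  move=> jN; rewrite lerDl lerD2l ler_pM2r// ler_nat jN andbT.
  by rewrite mulr_ge0// ltW.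
(* Either some block begins with a quiet segment of length [Delta], or every block has a large value
   in its initial segment. *)
have [[j [jN small]]|none] := pselect (exists j, (j < N)%N /\
    forall t, b j <= t <= b j + Delta -> enorm (x t) ^+ 2 <= eps * X).
  have /andP[bj1 bj2] := bN _ jN.
  have /andP[bj3 bj4] := bN _ (ltnW jN).
  rewrite bS in bj1 bj2.
  (* The history at [t1] is exactly the quiet segment, so the growth bound restarted there gives
     [2 gain eps X = X / 4]. *)
  pose t1 := b j + Delta.
  have X1 : hnorm (hist_at x t1) ^+ 2 <= eps * X.
    apply: (hnorm_hist_at_le cx (p := t1) (q := t1)); last by rewrite lexx.
    by move=> t; rewrite /t1 addrK; exact: small.
  have t1T : t1 <= p + T by rewrite /t1; lra.
  have sol1 : solves f0 x t1 (p + T).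
    by apply: solves_sub xsol => //; rewrite /t1; lra.
  apply: (hnorm_hist_at_le cx (p := t1) (q := p + T)); last by rewrite t1T lexx.
  move=> t tI.
  have tT : p + T - t1 <= T by rewrite /t1; lra.
  apply: (le_trans (growth_bound t1T tT cT sol1 tI)).
  apply: (@le_trans _ _ (2 * gain * (eps * X))).
    by rewrite ler_pM2l// mulr_gt0.
  rewrite heps le_eqVlt; apply/orP; left; apply/eqP; field.
  by rewrite gt_eqF.
have bad j : (j < N)%N -> exists2 s, b j <= s <= b j + Delta &
    eps * X < enorm (x s) ^+ 2.
  move=> jN; apply: contrapT => nex; apply: none; exists j; split=> // t tI.
  by rewrite leNgt; apply/negP => h; apply: nex; exists t.
(* If [X = 0], the growth bound makes [x] vanish, against the large value in block 0. Positivity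
   makes the final comparison strict. *)
have Xgt0 : 0 < X.
  have [s sI sX] := bad _ N0.
  rewrite lt_neqAle X0 andbT; apply/eqP => X0'.
  have sI' : p - Delta <= s <= p + T.
    move: sI; rewrite /b mul0r addr0 => /andP[s1 s2].
    have /andP[_] := bN _ N0; rewrite bS /b mul0r addr0 => h.
    by apply/andP; split; lra.
  have h := xM s sI'; rewrite -/X -X0' mulr0 in h.
  by move: sX; rewrite -X0' mulr0 ltNge h.
have Vj j : (j <= N)%N -> V (hist_at x (b j)) - V (hist_at x p) <=
    j%:R * ((c * (2 * gain) * (Delta + delta) - a * q * delta) * X).
  elim: j => [_|j IH jN]; first by rewrite /b mul0r addr0 subrr mul0r.
  have [s sI sX] := bad _ jN.
  have /andP[bj1 bj2] := bN _ jN.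
  have /andP[bj3 bj4] := bN _ (ltnW jN).
  rewrite bS in bj1 bj2.
  have xMj (t : R) : b j - Delta <= t <= b j + (Delta + delta) ->
      enorm (x t) ^+ 2 <= 2 * gain * X.
    by move=> /andP[h1 h2]; apply: xM; apply/andP; split; lra.
  have h := block_drop X0 sI (solves_sub bj3 bj2 xsol) xMj sX.
  have {}IH := IH (ltnW jN).
  rewrite bS -addn1 natrD mulrDl mul1r; lra.
(* Summing up, [0 <= V <= ahi X + (alo + ahi) X - N a q delta X], which the choice of [N] makes
   negative. *)
have := Vj _ (leqnn N).
have := V0 (@history_hist_at _ _ Delta x (b N) cx).
have /andP[_] := Vbnd (@history_hist_at _ _ Delta x p cx); rewrite -/X.
set K := N%:R * _.
have -> : K = 2 * gain * (c * T) * X - N%:R * (a * q * delta) * X.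
  by rewrite /K; ring.
have : 2 * gain * (c * T) * X <= (alo + ahi) * X.
  rewrite ler_pM2r//.
  have -> : alo + ahi = 2 * gain * (alo / 2).
    by rewrite /gain; field; rewrite gt_eqF.
  by rewrite ler_pM2l// mulr_gt0.
have : (2 * ahi + alo) * X < N%:R * (a * q * delta) * X by rewrite ltr_pM2r.
lra.
Qed.

(** With [j] the integer part of [t / T], [j] contractions followed by one growth bound give
    [|x t|^2 <= 2 gain 4^-j |x_0|^2]. *)
Lemma exponential_decay x (tau : R) : solves f0 x 0 tau ->
  forall t, 0 <= t <= tau ->
  enorm (x t) <= Num.sqrt (8 * gain) * hnorm (hist_at x 0) *
                 expR (- (ln 2 / T) * t).
Proof.
move=> xsol t /andP[t0 ttau]; have cx := xsol.1.
have D0 := Delta0; have TT := T0.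
have g0 := gain_gt0.
have geo j : j%:R * T <= tau ->
    hnorm (hist_at x (j%:R * T)) ^+ 2 <= 4^-1 ^+ j * hnorm (hist_at x 0) ^+ 2.
  elim: j => [_|j IH]; first by rewrite mul0r expr0 mul1r.
  have -> : j.+1%:R * T = j%:R * T + T by rewrite -addn1 natrD; ring.
  move=> jT.
  have jT0 : 0 <= j%:R * T by rewrite mulr_ge0// ltW.
  rewrite (le_trans (contraction (solves_sub jT0 jT xsol)))//.
  rewrite [4^-1 ^+ _]exprS -mulrA ler_pM2l ?invr_gt0// IH//; lra.
pose j := Num.truncn (t / T).
have /andP[j1 j2] : j%:R <= t / T < j.+1%:R.
  by apply: truncn_itv; rewrite divr_ge0// ltW.
have jt : j%:R * T <= t by rewrite -ler_pdivlMr.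
have tj : t < j%:R * T + T.
  by move: j2; rewrite ltr_pdivrMr// -natr1 mulrDl mul1r.
have jT0 : 0 <= j%:R * T by rewrite mulr_ge0// ltW.
have tjT : t - j%:R * T <= T by lra.
have tI : j%:R * T - Delta <= t <= t by rewrite lexx andbT; lra.
have h := growth_bound jt tjT cT (solves_sub jT0 ttau xsol) tI.
have {}h := le_trans h (ler_wpM2l (ltac:(by rewrite mulr_ge0// ltW) : 0 <= 2 * gain)
  (geo j (le_trans jt ttau))).
(* Since [j > t / T - 1]; the extra factor 4 turns [2 * gain] into [8 * gain]. *)
have pow : 4^-1 ^+ j <= 4 * expR (- (ln 2 / T) * t) ^+ 2.
  have -> : (4^-1 : R) = expR (- ln 2) ^+ 2.
    by rewrite expRN lnK ?posrE//; field.
  have -> : (4 : R) = expR (ln 2) ^+ 2 by rewrite lnK ?posrE//; ring.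
  rewrite exprAC -exprMn -expRD ler_pXn2r ?nnegrE ?exprn_ge0 ?expR_ge0//.
  rewrite -expRM_natl ler_expR mulrN mulNr lerNl opprD opprK.
  have -> : - ln 2 + ln 2 / T * t = ln 2 * (t / T - 1) :> R by ring.
  rewrite (mulrC _ (ln 2)) ler_pM2l ?ln_gt0 ?ltr1n//.
  by move: j2; rewrite -natr1; lra.
have h0 := hnorm_ge0 Delta0 (@history_hist_at _ _ Delta x 0 cx).
rewrite -(@ler_pXn2r _ 2) ?nnegrE ?enorm_ge0 ?mulr_ge0 ?sqrtr_ge0 ?expR_ge0//.
rewrite !exprMn (@sqr_sqrtr _ (8 * gain)) ?mulr_ge0 ?(ltW g0)//.
apply: (le_trans h).
set Y := hnorm _ ^+ 2; set e := expR _ ^+ 2 in pow *.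
have -> : 8 * gain * Y * e = 2 * gain * (4 * e * Y) by ring.
by rewrite ler_pM2l ?mulr_gt0// ler_wpM2r// sqr_ge0.
Qed.

End Decay.

(** * Existence and uniqueness for globally Lipschitz right-hand sides *)

Section Antiderivative.
Variables (R : realType) (n : nat).
Local Notation E := 'cV[R]_n.

Lemma antiderivative (g : R -> R) : continuous g ->
  exists G : R -> R, forall t : R, 0 <= t -> is_derive t 1 G (g t).
Proof.
(* The base point -1 makes every [t >= 0] interior, 0 included, so that the derivative there is
   two-sided. *)
move=> cg; exists (fun t => \int[lebesgue_measure]_(s in `[-1, t]) g s)%R.
move=> t t0.
have t1 : -1 < t by rewrite (lt_le_trans _ t0)// oppr_lt0.
have ig : lebesgue_measure.-integrable `[-1, t + 1] (EFin \o g).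
  apply: continuous_compact_integrable; first exact: segment_compact.
  exact: continuous_subspaceT.
have tt : t < t + 1 by rewrite ltrDl.
have [dG DG] := continuous_FTC1_closed tt ig t1 (cg t).
by split; [exact: dG|rewrite -derive1E; exact: DG].
Qed.

Lemma antiderivative_vec (g : R -> E) : continuous g ->
  exists G : R -> E, forall t : R, 0 <= t -> is_derive t 1 G (g t).
Proof.
move=> cg.
have H i : exists G : R -> R, forall t : R, 0 <= t -> is_derive t 1 G (g t i 0).
  apply: antiderivative => t.
  apply: (@continuous_comp _ _ _ g (fun v : E => v i 0)); first exact: cg.
  exact: coord_continuous.
have [G GP] := choice H.
exists (fun t => \col_i G i t) => t t0.
have dG : derivable (fun t : R => \col_i G i t : E) t 1.
  apply/derivable_mxP => i j.
  have -> : (fun x => (\col_i0 G i0 x : E) i j) = G i.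
    by apply/funext => x; rewrite mxE.
  by have [] := GP i t t0.
split=> //; rewrite derive_mx//; apply/colP => i; rewrite mxE.
have -> : (fun x => (\col_i0 G i0 x : E) i 0) = G i.
  by apply/funext => x; rewrite mxE.
by have [] := GP i t t0.
Qed.

Lemma is_derive_right_deriv (x : R -> E) (t : R) (w : E) :
  is_derive t 1 x w -> right_deriv x t w.
Proof.
move=> [dx <-] e e0.
have /cvg_enorm/(_ e e0) := dx.
move=> /nbhs_ballP[d/= d0 dP]; exists d => // h /andP[h0 hd].
have := dP h; rewrite /ball/= sub0r normrN gtr0_norm// gt_eqF// => /(_ hd isT).
have -> : h *: (1 : R) = h by exact: mulr1.
rewrite (addrC h) => H.
have -> : x (t + h) - x t - h *: 'D_1 x t =
    h *: (h^-1 *: (x (t + h) - x t) - 'D_1 x t).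
  by rewrite scalerBr scalerA mulfV ?gt_eqF// scale1r.
by rewrite enormZ gtr0_norm// mulrC ler_pM2r.
Qed.

Lemma is_derive_addc (G : R -> E) (t : R) (w c : E) :
  is_derive t 1 G w -> is_derive t 1 (fun s => G s + c) w.
Proof.
move=> dG.
have := @is_deriveD R R E G (cst c) t 1 w 0 dG (is_derive_cst _ _ _).
by rewrite addr0.
Qed.

Lemma right_derivP (x : R -> E) (t : R) (w : E) :
  right_deriv x t w <-> h^-1 *: (x (t + h) - x t) @[h --> 0^'+] --> w.
Proof.
have key (h : R) : 0 < h -> x (t + h) - x t - h *: w =
    h *: (h^-1 *: (x (t + h) - x t) - w).
  by move=> h0; rewrite scalerBr scalerA mulfV ?gt_eqF// scale1r.
split=> [xw|/cvg_enorm xw e e0].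
  apply/cvg_enorm => e e0; have [d d0 dP] := xw e e0.
  apply/nbhs_ballP; exists d => // h; rewrite /ball/= sub0r normrN => hd h0.
  have := dP h; rewrite h0 -(gtr0_norm h0) hd (gtr0_norm h0) => /(_ isT).
  by rewrite key// enormZ gtr0_norm// mulrC ler_pM2r.
have /nbhs_ballP[d/= d0 dP] := xw e e0; exists d => // h /andP[h0 hd].
rewrite key// enormZ gtr0_norm// mulrC ler_pM2r//; apply: dP => //.
by rewrite /ball/= sub0r normrN gtr0_norm.
Qed.

Lemma right_deriv_congr (x y : R -> E) (t d : R) (w : E) : 0 < d ->
  (forall s : R, t <= s < t + d -> x s = y s) ->
  right_deriv x t w -> right_deriv y t w.
Proof.
move=> d0 xy xw e e0; have [d' d'0 dP] := xw e e0.
exists (Num.min d d') => [|h]; first by rewrite lt_min d0.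
rewrite lt_min => /andP[h0 /andP[hd hd']].
rewrite -!xy ?lexx ?ltrDl//; last by rewrite ltrD2l hd lerDl ltW.
by apply: dP; rewrite h0.
Qed.

Lemma right_deriv_cst (v : E) (t : R) : right_deriv (fun=> v) t 0.
Proof.
move=> e e0; exists 1 => // h /andP[h0 _].
by rewrite subrr scaler0 subr0 enorm0 mulr_ge0// ltW.
Qed.

(* [v - (B / lam) * expR (lam * t)], with [v] the distance of the two curves,
   has nonpositive upper right Dini derivative. *)
Lemma compare_exp (x y wx wy : R -> E) (B lam t : R) : 0 <= t -> 0 < lam ->
  0 <= B -> continuous x -> continuous y -> x 0 = y 0 ->
  (forall s : R, 0 <= s < t -> right_deriv x s (wx s)) ->
  (forall s : R, 0 <= s < t -> right_deriv y s (wy s)) ->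
  (forall s : R, 0 <= s < t -> enorm (wx s - wy s) <= B * expR (lam * s)) ->
  enorm (x t - y t) <= B / lam * expR (lam * t).
Proof.
move=> t0 lam0 B0 cx cy xy0 xw yw ww.
pose v s := enorm (x s - y s) - B / lam * expR (lam * s).
have Bl0 : 0 <= B / lam by rewrite divr_ge0// ltW.
have cenorm : continuous (fun s => enorm (x s - y s)).
  move=> s; apply/cvgrPdist_le => e e0.
  have /cvg_enorm/(_ e e0) : x u - y u @[u --> s] --> x s - y s.
    by apply: cvgB; [exact: cx|exact: cy].
  by apply: filterS => u; rewrite distrC; apply: le_trans; exact: enorm_sub_le.
have cv : continuous v.
  move=> s; apply: cvgB; first exact: cenorm.
  apply: cvgM; first exact: cvg_cst.
  apply: (@continuous_comp _ _ _ (fun s => lam * s) expR); last first.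
    exact: continuous_expR.
  by apply: cvgM; [exact: cvg_cst|exact: cvg_id].
suff : v t - v 0 <= 0 * (t - 0).
  rewrite mul0r /v mulr0 xy0 subrr enorm0 expR0; lra.
apply: dini_le => // s st e e0; rewrite add0r.
have e20 : 0 < e / 2 by rewrite divr_gt0.
have [d1 d10 dP1] := xw s st _ e20.
have [d2 d20 dP2] := yw s st _ e20.
exists (Num.min d1 d2) => [|h]; first by rewrite lt_min d10.
rewrite lt_min => /andP[h0 /andP[h1 h2]].
have := dP1 h; have := dP2 h; rewrite h0 h1 h2 => /(_ isT) q2 /(_ isT) q1.
have q3 := ww s st.
have q : enorm (x (s + h) - y (s + h)) <= enorm (x s - y s) +
    h * enorm (wx s - wy s) + e * h.
  have -> : x (s + h) - y (s + h) = (x s - y s) + h *: (wx s - wy s)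
      + ((x (s + h) - x s - h *: wx s) - (y (s + h) - y s - h *: wy s)).
    by apply/colP => i; rewrite !mxE; ring.
  rewrite (le_trans (enormD _ _))// lerD//.
    by rewrite (le_trans (enormD _ _))// enormZ gtr0_norm.
  by rewrite (le_trans (enormD _ _))// enormN (splitr e) mulrDl lerD.
have q4 : h * enorm (wx s - wy s) <= h * (B * expR (lam * s)) by rewrite ler_pM2l.
(* By [1 + z <= exp z], the comparison function grows by at least [h B exp (lam s)], which absorbs
   the first-order growth of the distance. *)
have q5 : (1 + lam * h) * expR (lam * s) <= expR (lam * (s + h)).
  have -> : lam * (s + h) = lam * h + lam * s by ring.
  by rewrite expRD ler_wpM2r ?expR_ge0// expR_ge1Dx.
have q6 := ler_wpM2l Bl0 q5.
have q7 : B / lam * ((1 + lam * h) * expR (lam * s)) =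
    B / lam * expR (lam * s) + h * (B * expR (lam * s)).
  by field; rewrite gt_eqF.
rewrite /v; lra.
Qed.

End Antiderivative.

Lemma geometric_small (R : realType) (C e : R) : 0 < e ->
  exists k : nat, C * 2^-1 ^+ k <= e.
Proof.
move=> e0; pose k := (Num.truncn (`|C| / e)).+1; exists k.
have Ck : `|C| / e <= k%:R.
  have /andP[_] := truncn_itv (divr_ge0 (normr_ge0 C) (ltW e0)).
  exact: ltW.
have k2 : (k%:R : R) <= 2 ^+ k by rewrite -natrX ler_nat ltnW// ltn_expl.
rewrite exprVn ler_pdivrMr ?exprn_gt0// (le_trans (ler_norm _))//.
rewrite mulrC -ler_pdivrMr// (le_trans Ck)//.
Qed.

(** * Picard iteration in an exponentially weighted norm *)

Section Picard.
Variables (R : realType) (n : nat) (Delta : R).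
Hypothesis Delta0 : 0 <= Delta.
Local Notation E := 'cV[R]_n.
Local Notation history := (@history R Delta n).
Local Notation hnorm := (@hnorm R Delta n).
Implicit Types (x y : R -> E).

(* The weight [expR (2 * L * t)] makes one Picard step halve the distance on
   the whole half-line at once. *)
Lemma picard_halves x y x' y' wx wy (L C T : R) : 0 < L -> 0 <= C ->
  continuous x -> continuous y -> continuous x' -> continuous y' ->
  (forall s : R, - Delta <= s <= 0 -> x s = y s) -> x' 0 = y' 0 ->
  (forall s : R, 0 <= s < T -> right_deriv x' s (wx s)) ->
  (forall s : R, 0 <= s < T -> right_deriv y' s (wy s)) ->
  (forall s : R, 0 <= s < T ->
     enorm (wx s - wy s) <= L * hnorm (hist_at x s \- hist_at y s)) ->
  (forall s : R, 0 <= s <= T -> enorm (x s - y s) <= C * expR (2 * L * s)) ->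
  forall t : R, 0 <= t <= T -> enorm (x' t - y' t) <= C / 2 * expR (2 * L * t).
Proof.
move=> L0 C0 cx cy cx' cy' xy xy0 xw yw ww xyC t /andP[t0 tT].
(* The form [B / lam] of [compare_exp] with [B = L * C] and [lam = 2 * L]. *)
have -> : C / 2 = L * C / (2 * L) by field; rewrite gt_eqF.
have sT s : 0 <= s < t -> 0 <= s < T.
  by move=> /andP[-> st]; rewrite (lt_le_trans st).
apply: (@compare_exp _ _ x' y' wx wy) => //.
- by rewrite mulr_gt0.
- by rewrite mulr_ge0// ltW.
- by move=> s /sT; exact: xw.
- by move=> s /sT; exact: yw.
- move=> s st; have /andP[s0 sT'] := sT s st.
  apply: (le_trans (ww s (sT s st))); rewrite -mulrA ler_pM2l//.
  apply: hnorm_le => // tau /andP[tau1 tau2]; rewrite /hist_at/=.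
  have [st0|st0] := leP (s + tau) 0.
    rewrite xy ?subrr ?enorm0; first by rewrite mulr_ge0// expR_ge0.
    by apply/andP; split; lra.
  have stT : 0 <= s + tau <= T by apply/andP; split; lra.
  apply: (le_trans (xyC _ stT)).
  rewrite ler_wpM2l// ler_expR ler_pM2l; first by lra.
  by rewrite mulr_gt0.
Qed.

(** Each solution is its own Picard image, so the bound on the weighted distance can be halved
    indefinitely. The Lipschitz bound is asked only along the two curves, so a local constant will
    do. *)
Lemma solution_unique (f : (R -> E) -> E) x y (L T : R) : 0 < L ->
  solves f x 0 T -> solves f y 0 T ->
  (forall s : R, - Delta <= s <= 0 -> x s = y s) ->
  (forall s : R, 0 <= s < T -> enorm (f (hist_at x s) - f (hist_at y s)) <=
     L * hnorm (hist_at x s \- hist_at y s)) ->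
  forall t : R, 0 <= t <= T -> x t = y t.
Proof.
move=> L0 [cx xf] [cy yf] xy Lf t tT.
have xy0 : x 0 = y 0 by apply: xy; rewrite lexx oppr_le0 Delta0.
have [M M0 MP] : exists2 M, 0 <= M &
    forall s : R, 0 <= s <= T -> enorm (x s - y s) <= M.
  apply: (@continuous_bounded _ _ (fun s => x s - y s)) => s.
  by apply: cvgB; [exact: cx|exact: cy].
have H k : forall s : R, 0 <= s <= T ->
    enorm (x s - y s) <= M * 2^-1 ^+ k * expR (2 * L * s).
  elim: k => [s sT|k IH s sT].
    rewrite expr0 mulr1 (le_trans (MP s sT))// ler_peMr// -expR0 ler_expR.
    by rewrite !mulr_ge0// ?(ltW L0)//; case/andP: sT.
  rewrite exprSr mulrA.
  apply: (picard_halves L0 _ cx cy cx cy xy xy0 xf yf Lf IH sT).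
  by rewrite mulr_ge0// exprn_ge0.
apply/eqP; rewrite -subr_eq0; apply/eqP/enorm_eq0/eqP.
rewrite eq_le enorm_ge0 andbT; apply/ler_addgt0Pr => e e0; rewrite add0r.
have [k kP] := geometric_small (M * expR (2 * L * t)) e0.
by apply: le_trans (H k t tT) _; rewrite mulrAC.
Qed.

Variables (f : (R -> E) -> E) (L : R) (x0 : R -> E).
Hypothesis L0 : 0 < L.
Hypothesis f_lip : forall phi psi, history phi -> history psi ->
  enorm (f phi - f psi) <= L * hnorm (phi \- psi).
Hypothesis x0_hist : history x0.

(** The initial history prolonged by its end values; it is the zeroth iterate. *)
Let xini t := x0 (clamp (- Delta) 0 t).

Let xini_continuous : continuous xini.
Proof.
by apply: continuous_clamp x0_hist => //; rewrite oppr_le0.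
Qed.

(** [y] is the Picard image of [x], described by derivatives instead of an integral: two-sided ones
    as in [is_solution], right ones for the comparison estimates. *)
Let picard x y : Prop := [/\ continuous y, (forall t : R, t <= 0 -> y t = xini t),
  (forall t : R, 0 < t -> is_derive t 1 y (f (hist_at x t))) &
  (forall t : R, 0 <= t -> right_deriv y t (f (hist_at x t)))].

Let picard_step x : continuous x -> exists y, picard x y.
Proof.
move=> cx.
have cf : continuous (fun t => f (hist_at x t)).
  apply: enorm_continuous => t e e0.
  have [d d0 dP] := hist_at_continuous Delta0 t cx (divr_gt0 e0 L0).
  exists d => // s /dP h.
  have hs := @history_hist_at _ _ Delta x s cx.
  have ht := @history_hist_at _ _ Delta x t cx.
  by rewrite (le_trans (f_lip hs ht))// mulrC -ler_pdivlMr.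
have [G GP] := antiderivative_vec cf.
have cG t : 0 <= t -> {for t, continuous G}.
  move=> t0; apply: differentiable_continuous; apply/derivable1_diffP.
  by have [] := GP t t0.
(* The increment of [G] is frozen for [t <= 0], so [y] follows the initial history there and equals
   [G] up to a constant afterwards. *)
pose y t := xini t + (G (Num.max t 0) - G 0).
have ypos t : 0 <= t -> y t = G t + (x0 0 - G 0).
  move=> t0; rewrite /y max_l// /xini /clamp min_l// max_r ?oppr_le0//.
  by rewrite addrC addrAC addrA.
exists y; split.
- move=> t; apply: cvgD; first exact: xini_continuous.
  apply: cvgB; last exact: cvg_cst.
  apply: (@continuous_comp _ _ _ (fun u : R => Num.max u 0) G).
    by apply: (@continuous_max _ _ id (fun=> 0)); [exact: cvg_id|exact: cvg_cst].
  by apply: cG; rewrite le_max lexx orbT.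
- by move=> t t0; rewrite /y max_r// subrr addr0.
- move=> t t0.
  apply: (@near_eq_is_derive R R E (fun s => G s + (x0 0 - G 0)) y).
    near=> s; rewrite ypos//; apply/ltW; near: s; exact: lt_nbhsr.
  exact: (is_derive_addc (x0 0 - G 0) (GP t (ltW t0))).
- move=> t t0 e e0.
  have [d d0 dP] := is_derive_right_deriv (GP t t0) e0.
  exists d => // h hd; have /andP[h0 _] := hd.
  rewrite !ypos// ?addr_ge0 ?(ltW h0)// opprD addrACA subrr addr0.
  exact: dP.
Unshelve. all: by end_near. Qed.

(** Successive iterates are at geometrically decreasing weighted distance, hence Cauchy at each
    time; the limit is continuous and fixed by the Picard map. *)
Lemma global_solution : exists x, [/\ continuous x,
  (forall t : R, - Delta <= t <= 0 -> x t = x0 t),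
  (forall t : R, 0 < t -> is_derive t 1 x (f (hist_at x t))) &
  (forall t : R, 0 <= t -> right_deriv x t (f (hist_at x t)))].
Proof.
suff [x [cx xini' dx rdx]] : exists x, picard x x.
  exists x; split=> // t tD; rewrite xini'; last by case/andP: tD.
  by rewrite /xini clamp_id.
have [Phi PhiP] : {Phi : (R -> E) -> (R -> E) &
    forall x, continuous x -> picard x (Phi x)}.
  apply: (@choice _ _ (fun x y => continuous x -> picard x y)) => x.
  have [cx|ncx] := pselect (continuous x); last by exists x.
  by have [y yP] := picard_step cx; exists y.
pose X k := iter k Phi xini.
have cX k : continuous (X k).
  by elim: k => [//|k IH] /=; have [] := PhiP _ IH.
have XS k : picard (X k) (X k.+1) by exact: PhiP.
have Xini k t : t <= 0 -> X k t = xini t.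
  by case: k => [//|k]; have [_ + _ _] := XS k; apply.
have X0 k : X k 0 = x0 0.
  by rewrite Xini// /xini clamp_id// lexx oppr_le0 Delta0.
pose lam := 2 * L.
have lam0 : 0 < lam by rewrite mulr_gt0.
(* [B] bounds [f] along [xini], whose histories are at distance at most [2 * hnorm x0] from one
   another; the first step then has weighted size at most [B / lam]. *)
pose B := enorm (f xini) + L * (hnorm x0 + hnorm x0).
have hx0 := hnorm_ge0 Delta0 x0_hist.
have B0 : 0 <= B.
  by rewrite addr_ge0 ?enorm_ge0// mulr_ge0 ?(ltW L0)// addr_ge0.
pose C := B / lam.
have C0 : 0 <= C by rewrite divr_ge0// ltW.
have hini : history xini by exact: continuous_subspaceT.
have xini_le t : enorm (xini t) <= hnorm x0.
  apply: (hnorm_ub Delta0 x0_hist); apply: clamp_itv.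
  by rewrite oppr_le0.
have step k t : 0 <= t ->
    enorm (X k.+1 t - X k t) <= C * 2^-1 ^+ k * expR (lam * t).
  elim: k t => [|k IH] t t0.
    have [c1 _ _ r1] := XS 0.
    have -> : X 0%N t = x0 0.
      by rewrite /X /= /xini /clamp min_l// max_r// oppr_le0.
    rewrite expr0 mulr1.
    apply: (@compare_exp _ _ (X 1) (fun=> x0 0) (fun s => f (hist_at xini s))
      (fun=> 0) B lam t) => //.
    - by move=> s; exact: cvg_cst.
    - by move=> s /andP[s0 _]; exact: r1.
    - by move=> s _; exact: right_deriv_cst.
    - move=> s /andP[s0 _]; rewrite subr0.
      have hs := @history_hist_at _ _ Delta xini s xini_continuous.
      have -> : f (hist_at xini s) = f xini + (f (hist_at xini s) - f xini).
        by rewrite addrC subrK.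
      apply: (@le_trans _ _ B); last first.
        rewrite ler_peMr// -expR0 ler_expR mulr_ge0// ltW//.
      rewrite (le_trans (enormD _ _))// lerD2l (le_trans (f_lip hs hini))//.
      rewrite ler_pM2l//; apply: hnorm_le => // tau _.
      apply: (le_trans (enormD _ _)); rewrite enormN; apply: lerD; exact: xini_le.
  have [c1 _ _ r1] := XS k; have [c2 _ _ r2] := XS k.+1.
  rewrite exprSr mulrA.
  apply: (@picard_halves (X k.+1) (X k) (X k.+2) (X k.+1)
    (fun s => f (hist_at (X k.+1) s)) (fun s => f (hist_at (X k) s)) L _ t) => //.
  - by rewrite mulr_ge0// exprn_ge0.
  - by move=> s /andP[_ s0]; rewrite !Xini.
  - by rewrite !X0.
  - by move=> s /andP[s0 _]; exact: r2.
  - by move=> s /andP[s0 _]; exact: r1.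
  - by move=> s _; apply: f_lip; exact: history_hist_at.
  - by move=> s /andP[s0 _]; exact: IH.
  - by rewrite t0 lexx.
have tail k m t : 0 <= t ->
    enorm (X (k + m)%N t - X k t) <= 2 * C * 2^-1 ^+ k * expR (lam * t).
  move=> t0; set z := expR _.
  have z0 : 0 <= z by exact: expR_ge0.
  (* The factor [1 - 2^-m] of the partial geometric sum makes induction on [m] work. *)
  suff : enorm (X (k + m)%N t - X k t) <= 2 * C * 2^-1 ^+ k * z * (1 - 2^-1 ^+ m).
    have c0 : 0 <= 2 * C * 2^-1 ^+ k * z.
      by apply: mulr_ge0 => //; apply: mulr_ge0; [exact: mulr_ge0|exact: exprn_ge0].
    by move=> h; rewrite (le_trans h)// ler_piMr// gerBl exprn_ge0.
  elim: m => [|m IH]; first by rewrite addn0 subrr enorm0 expr0 subrr mulr0.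
  have -> : X (k + m.+1)%N t - X k t =
      (X (k + m).+1 t - X (k + m)%N t) + (X (k + m)%N t - X k t).
    by rewrite addnS addrA subrK.
  apply: (le_trans (enormD _ _)); have := step (k + m)%N t t0.
  rewrite exprD exprS -/z => h.
  apply: (le_trans (lerD h IH)); rewrite le_eqVlt; apply/orP; left; apply/eqP.
  by field.
have Xcvg t : cvg (X k t @[k --> \oo]).
  have [t0|/ltW t0] := leP 0 t; last first.
    apply/cvg_ex; exists (xini t); rewrite (_ : (fun k => X k t) = fun=> xini t).
      exact: cvg_cst.
    by apply/funext => k; rewrite Xini.
  apply: cauchy_cvg; apply: cauchy_exP => e e0.
  have [k kP] := geometric_small (2 * C * expR (lam * t)) (divr_gt0 e0 (ltr0n R 2)).
  exists (X k t); exists k => // m /= km.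
  rewrite -ball_normE /ball_/= distrC (le_lt_trans (norm_le_enorm _))//.
  rewrite -(subnKC km) (le_lt_trans (tail _ _ _ t0))// mulrAC.
  by rewrite (le_lt_trans kP)// ltr_pdivrMr// ltr_pMr// ltr1n.
pose x t := lim (X k t @[k --> \oo]).
have Xx k t : 0 <= t -> enorm (x t - X k t) <= 2 * C * 2^-1 ^+ k * expR (lam * t).
  move=> t0; apply/ler_addgt0Pr => e e0.
  have /cvg_enorm/(_ e e0)[N _ NP] := Xcvg t.
  have := NP (k + N)%N; rewrite /= leq_addl => /(_ isT) h.
  have -> : x t - X k t = (X (k + N)%N t - X k t) - (X (k + N)%N t - x t).
    by rewrite opprB [RHS]addrC addrA subrK.
  by rewrite (le_trans (enormD _ _))// enormN lerD// tail.
have xneg t : t <= 0 -> x t = xini t.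
  move=> t0; rewrite /x (_ : (fun k => X k t) = fun=> xini t).
    exact: lim_cst.
  by apply/funext => k; rewrite Xini.
have cx : continuous x.
  apply: enorm_continuous => t e e0.
  (* [z] bounds the weight on the unit neighbourhood of [t], where convergence is therefore
     uniform. *)
  pose z := expR (lam * (`|t| + 1)).
  have e30 : 0 < e / 3 by rewrite divr_gt0.
  have [k kP] := geometric_small (2 * C * z) e30.
  have near_t s : `|s - t| < 1 -> enorm (x s - X k s) <= e / 3.
    move=> st; have [s0|/ltW s0] := leP 0 s; last first.
      by rewrite xneg// Xini// subrr enorm0 ltW.
    rewrite (le_trans (Xx k s s0))// (le_trans _ kP)// [leRHS]mulrAC.
    have c0 : 0 <= 2 * C * 2^-1 ^+ k.
      by apply: mulr_ge0; [exact: mulr_ge0|exact: exprn_ge0].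
    apply: ler_wpM2l => //; rewrite ler_expR ler_pM2l//.
    have := ler_norm t; move: st; rewrite ltr_norml => /andP[]; lra.
  have [d d0 dP] := continuous_enorm t (cX k) e30.
  exists (Num.min d 1) => [|s]; first by rewrite lt_min d0 ltr01.
  rewrite lt_min => /andP[sd s1].
  have -> : x s - x t = (x s - X k s) + (X k s - X k t) - (x t - X k t).
    by rewrite addrA subrK opprB addrA subrK.
  have -> : e = e / 3 + e / 3 + e / 3 by field.
  rewrite (le_trans (enormD _ _))// enormN lerD//; last first.
    by apply: near_t; rewrite subrr normr0.
  by rewrite (le_trans (enormD _ _))// lerD ?near_t ?dP.
(* [Phi x] and [x] are both within a multiple of [2^-k] of [X k.+1], for every [k], hence equal. *)
have px := PhiP x cx; have [cy yini _ ry] := px.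
suff e : Phi x = x by exists x; move: px; rewrite e.
apply/funext => t; have [t0|/ltW t0] := leP 0 t; last by rewrite yini// xneg.
apply/eqP; rewrite -subr_eq0; apply/eqP/enorm_eq0/eqP.
rewrite eq_le enorm_ge0 andbT; apply/ler_addgt0Pr => e e0; rewrite add0r.
have [k kP] := geometric_small (2 * C * expR (lam * t)) e0.
have [c1 _ _ r1] := XS k.
have h1 : enorm (Phi x t - X k.+1 t) <= 2 * C * 2^-1 ^+ k / 2 * expR (lam * t).
  apply: (@picard_halves x (X k) (Phi x) (X k.+1)
    (fun s => f (hist_at x s)) (fun s => f (hist_at (X k) s)) L _ t) => //.
  - by apply: mulr_ge0; [exact: mulr_ge0|exact: exprn_ge0].
  - by move=> s /andP[_ s0]; rewrite xneg// Xini.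
  - by rewrite yini// X0 /xini clamp_id// lexx oppr_le0 Delta0.
  - by move=> s /andP[s0 _]; exact: ry.
  - by move=> s /andP[s0 _]; exact: r1.
  - by move=> s _; apply: f_lip; exact: history_hist_at.
  - by move=> s /andP[s0 _]; exact: Xx.
  - by rewrite t0 lexx.
have h2 := Xx k.+1 t t0.
have -> : Phi x t - x t = (Phi x t - X k.+1 t) - (x t - X k.+1 t).
  by rewrite opprB addrA subrK.
rewrite (le_trans (enormD _ _))// enormN (le_trans (lerD h1 h2))//.
rewrite (le_trans _ kP)// exprS le_eqVlt; apply/orP; left; apply/eqP.
by field.
Qed.

End Picard.

(** * Truncation and maximal solutions *)

Section Truncation.
Variables (R : realType) (n : nat) (r : R).
Local Notation E := 'cV[R]_n.

(** Truncating by coordinates reduces nonexpansiveness to that of [clamp], and still fixes the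
    Euclidean ball of radius [r]. *)
Definition truncate (v : E) : E := \col_i clamp (- r) r (v i 0).

Lemma truncate_dist (u v : E) : enorm (truncate u - truncate v) <= enorm (u - v).
Proof.
rewrite -(@ler_pXn2r _ 2) ?nnegrE ?enorm_ge0// !enorm_sqr ler_sum// => i _.
rewrite !mxE -real_normK ?num_real// -[leRHS]real_normK ?num_real//.
by rewrite ler_pXn2r ?nnegrE// clamp_dist.
Qed.

Lemma truncate_id (v : E) : enorm v <= r -> truncate v = v.
Proof.
move=> vr; apply/colP => i; rewrite mxE clamp_id//.
by rewrite -ler_norml (le_trans (coord_le_enorm v i)).
Qed.

Lemma truncate_le (v : E) : 0 <= r -> enorm (truncate v) <= n%:R * r.
Proof.
move=> r0; apply: enorm_le_coord => i; rewrite mxE ler_norml.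
by apply: clamp_itv; rewrite ge0_cp.
Qed.

Lemma truncate_continuous : continuous truncate.
Proof.
move=> v; apply/(@cvg_enorm R n _ (nbhs v) (nbhs_filter v)) => e e0.
have /(@cvg_enorm R n _ (nbhs v) (nbhs_filter v) id v)/(_ e e0) :
    u @[u --> v] --> v by exact: cvg_id.
by apply: filterS => u; apply: le_trans; exact: truncate_dist.
Qed.

Lemma history_truncate (Delta : R) (phi : R -> E) :
  history Delta phi -> history Delta (truncate \o phi).
Proof.
move=> hphi s; apply: (@continuous_comp _ _ _ (phi : subspace `[- Delta, 0] -> E)).
  exact: hphi.
exact: truncate_continuous.
Qed.

End Truncation.

(** * From the a priori bound to global existence, uniqueness and decay *)

Section GlobalExponentialStability.
Variables (R : realType) (n : nat) (Delta : R).
Hypothesis Delta0 : 0 <= Delta.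
Local Notation E := 'cV[R]_n.
Local Notation history := (@history R Delta n).
Local Notation hnorm := (@hnorm R Delta n).

(** Histories are total functions, but those met below are compared on [[- Delta, 0]] only; there
    the difference has norm 0. *)
Lemma lipschitz_ext (f : (R -> E) -> E) (phi psi : R -> E) :
  lipschitz_on_bounded Delta (@enorm R n) f -> history phi -> history psi ->
  (forall tau : R, - Delta <= tau <= 0 -> phi tau = psi tau) -> f phi = f psi.
Proof.
move=> flip h1 h2 pp.
have [L _ LP] := lipschitz_ball Delta0 (Num.max (hnorm phi) (hnorm psi)) flip.
apply/eqP; rewrite -subr_eq0; apply/eqP/enorm_eq0/eqP.
rewrite eq_le enorm_ge0 andbT.
have := LP _ _ h1 h2; rewrite !le_max !lexx orbT => /(_ isT isT) h.
apply: (le_trans h).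
have -> : hnorm (phi \- psi) = 0.
  apply/eqP; rewrite eq_le (hnorm_ge0 Delta0 (historyB h1 h2)) andbT.
  by apply: hnorm_le => // tau tauD; rewrite /= pp// subrr enorm0.
by rewrite mulr0.
Qed.

(** The decay on bounded time intervals is an a priori bound: it keeps the solution of the truncated
    equation below the truncation level, where it solves the original equation. *)
Lemma GES_of_decay (f0 : (R -> E) -> E) (k eta : R) : 0 < k -> 0 < eta ->
  lipschitz_on_bounded Delta (@enorm R n) f0 ->
  (forall x (T : R), solves f0 x 0 T -> forall t : R, 0 <= t <= T ->
     enorm (x t) <= k * hnorm (hist_at x 0) * expR (- eta * t)) ->
  GES Delta f0.
Proof.
move=> k0 eta0 flip decay; exists k, eta; split=> // x0 hx0.
have hX := hnorm_ge0 Delta0 hx0.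
have D0 := Delta0.
set X := hnorm x0 in hX *.
have kX : 0 <= k * X by rewrite mulr_ge0// ltW.
(* [k * X] bounds later values, [X] the initial ones, and 1 is the margin for the step to the right
   in [xsmall]. *)
pose r := k * X + X + 1.
have r0 : 0 <= r by rewrite /r; lra.
have [L L0 LP] := lipschitz_ball Delta0 (n%:R * r) flip.
pose ft (phi : R -> E) := f0 (truncate r \o phi).
have trunc_hist (phi : R -> E) : hnorm (truncate r \o phi) <= n%:R * r.
  by apply: hnorm_le => // tau _; exact: truncate_le.
have ft_lip (phi psi : R -> E) : history phi -> history psi ->
    enorm (ft phi - ft psi) <= L * hnorm (phi \- psi).
  move=> h1 h2.
  have := LP _ _ (history_truncate (r := r) h1) (history_truncate (r := r) h2)
    (trunc_hist _) (trunc_hist _).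
  move=> /le_trans; apply; rewrite ler_pM2l//; apply: hnorm_le => // tau tauD.
  rewrite (le_trans (truncate_dist _ _ _))//.
  exact: (hnorm_ub Delta0 (historyB h1 h2) tauD).
have [x [cx xini dx rdx]] := global_solution Delta0 L0 ft_lip hx0.
have hist0 (y : R -> E) : (forall t : R, - Delta <= t <= 0 -> y t = x0 t) ->
    hnorm (hist_at y 0) = X.
  by move=> yini; apply: hnorm_ext => tau tauD; rewrite /hist_at add0r yini.
have small_initially (y : R -> E) (t : R) :
    (forall t : R, - Delta <= t <= 0 -> y t = x0 t) ->
    - Delta <= t <= 0 -> enorm (y t) <= r.
  move=> yini tD; rewrite yini// (le_trans (hnorm_ub Delta0 hx0 tD))//.
  by rewrite -/X /r; lra.
have small_later (y : R -> E) (T t : R) : solves f0 y 0 T ->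
    (forall t : R, - Delta <= t <= 0 -> y t = x0 t) ->
    0 <= t <= T -> enorm (y t) <= k * X.
  move=> ysol yini tT; have /andP[t0 _] := tT.
  rewrite (le_trans (decay y T ysol t tT))// hist0// ler_piMr//.
  by rewrite -expR0 ler_expR mulNr oppr_le0 mulr_ge0// ltW.
have ft_f0 (t : R) : 0 <= t ->
    (forall s : R, - Delta <= s <= t -> enorm (x s) <= r) ->
    ft (hist_at x t) = f0 (hist_at x t).
  move=> t0 xr; have hx := @history_hist_at _ _ Delta x t cx.
  apply: (lipschitz_ext flip (history_truncate (r := r) hx) hx) => tau /andP[h1 h2].
  by rewrite /= truncate_id// /hist_at xr//; apply/andP; split; lra.
have sol_of_small (t : R) : (forall s : R, 0 <= s < t -> enorm (x s) <= r) ->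
    solves f0 x 0 t.
  move=> xr; split=> // s /andP[s0 st]; rewrite -ft_f0//; first exact: rdx.
  move=> u /andP[u1 u2]; have [u0|/ltW u0] := leP 0 u.
    by apply: xr; rewrite u0 (le_lt_trans u2).
  by apply: small_initially => //; rewrite u1.
(* Up to [t] the curve solves the original equation, so it obeys the sharper bound [k * X];
   continuity then keeps it below [r] a little longer. *)
have xsmall (T : R) : forall t : R, 0 <= t <= T -> enorm (x t) <= r.
  apply: (real_induction (a := 0) (b := T)).
  - by apply: small_initially => //; rewrite lexx oppr_le0 Delta0.
  - move=> t /andP[t0 tT] xr.
    have xt : enorm (x t) <= k * X.
      apply: (small_later x t t) => //; last by rewrite t0 lexx.
      by apply: sol_of_small => s /andP[s0 st]; apply: xr; rewrite s0 ltW.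
    have [d d0 dP] := continuous_enorm t cx ltr01.
    exists d => // s /andP[ts sd] _.
    have := dP s; rewrite gtr0_norm ?subr_gt0// ltrBlDl sd => /(_ isT) h.
    have := le_trans (ler_norm _) (enorm_sub_le (x s) (x t)).
    by rewrite /r; lra.
  - move=> t /andP[t0 tT] xr.
    have xt : enorm (x t) <= k * X.
      apply: (small_later x t t) => //; last by rewrite (ltW t0) lexx.
      exact: sol_of_small.
    by rewrite /r; lra.
have xsol (t : R) : solves f0 x 0 t.
  by apply: sol_of_small => s /andP[s0 st]; apply: (xsmall s); rewrite s0 lexx.
have xr (t : R) : - Delta <= t -> enorm (x t) <= r.
  move=> tD; have [t0|/ltW t0] := leP 0 t.
    by apply: (xsmall t); rewrite t0 lexx.
  by apply: small_initially => //; rewrite tD.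
have ftE (t : R) : 0 <= t -> ft (hist_at x t) = f0 (hist_at x t).
  by move=> t0; apply: ft_f0 => // s /andP[sD _]; exact: xr.
exists x; last first.
  move=> t t0; have := decay x t (xsol t) t; rewrite t0 lexx hist0//.
  exact.
split.
  split=> //.
  - exact: continuous_subspaceT.
  - by move=> t t0 _; rewrite -ftE ?(ltW t0)//; exact: dx.
  - have /right_derivP := rdx 0 (lexx 0).
    by rewrite -ftE//; under eq_fun do rewrite add0r.
move=> y S [S0 cy yini dy rdy]; split=> [|t tD tS]; first exact: leey.
have [t0|t0] := leP t 0; first by rewrite yini ?xini// tD.
have Dt : - Delta <= t by rewrite (le_trans _ (ltW t0))// oppr_le0.
(* The competitor [y] is known to be continuous on [[- Delta, S)]; stopped at [t], it becomes
   globally continuous with the same histories up to time [t]. *)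
pose yc s := y (clamp (- Delta) t s).
have ycE s : - Delta <= s <= t -> yc s = y s by move=> h; rewrite /yc clamp_id.
have cyc : continuous yc.
  apply: continuous_clamp cy => // s; rewrite /= in_itv/= => /andP[h1 h2].
  by split=> //; rewrite (le_lt_trans _ tS)// lee_fin.
have ycini (s : R) : - Delta <= s <= 0 -> yc s = x0 s.
  move=> /andP[h1 h2]; rewrite ycE; last by rewrite h1 (le_trans h2)// ltW.
  by apply: yini; rewrite h1.
have ychist (s tau : R) : 0 <= s <= t -> - Delta <= tau <= 0 ->
    hist_at yc s tau = hist_at y s tau.
  move=> /andP[h1 h2] /andP[h3 h4]; rewrite /hist_at ycE//.
  by apply/andP; split; lra.
have yhist (s : R) : 0 <= s <= t -> history (hist_at y s).
  move=> st; apply: (@subspace_eq_continuous _ _ _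
    (hist_at yc s : subspace `[- Delta, 0] -> E)); last exact: history_hist_at.
  by move=> tau; rewrite inE /= in_itv/= => tauD; exact: ychist.
have f0yc (s : R) : 0 <= s <= t -> f0 (hist_at y s) = f0 (hist_at yc s).
  move=> st; apply: (lipschitz_ext flip (yhist s st)).
    exact: history_hist_at.
  by move=> tau tauD; rewrite ychist.
have ycsol : solves f0 yc 0 t.
  split=> // s /andP[s0 st].
  have s01 : 0 <= s <= t by rewrite s0 ltW.
  rewrite -f0yc//.
  apply: (@right_deriv_congr _ _ y yc s (t - s)); first by rewrite subr_gt0.
    move=> u /andP[h1 h2]; rewrite ycE//; apply/andP; split; lra.
  move: s0; rewrite le_eqVlt => /orP[/eqP <-|s0].
    by apply/right_derivP; under eq_fun do rewrite add0r.
  apply: is_derive_right_deriv; apply: dy => //.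
  by rewrite (lt_trans _ tS)// lte_fin.
have ycr (s : R) : - Delta <= s <= t -> enorm (yc s) <= r.
  move=> /andP[sD st]; have [s0|/ltW s0] := leP 0 s.
    have := small_later yc t s ycsol ycini.
    by rewrite s0 st => /(_ isT); rewrite /r; lra.
  by apply: small_initially => //; rewrite sD.
(* Both curves stay in the ball of radius [r], where one Lipschitz constant of [f0] serves. *)
have [K K0 KP] := lipschitz_ball Delta0 r flip.
have t01 : 0 <= t <= t by rewrite ltW// lexx.
rewrite -(ycE t); last by rewrite Dt lexx.
apply: (@solution_unique _ _ Delta Delta0 f0 yc x K t K0 ycsol (xsol t)) => //.
  by move=> s sD; rewrite ycini// xini.
move=> s /andP[s0 st]; apply: KP; [exact: history_hist_at..| |].
  apply: hnorm_le => // tau /andP[h1 h2]; apply: ycr.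
  by apply/andP; split; lra.
by apply: hnorm_le => // tau /andP[h1 h2]; apply: xr; lra.
Qed.

End GlobalExponentialStability.

(** * Choice of the constants and conclusion *)

Theorem corollary2 (R : realType) (Delta : R) (n : nat)
    (alo ahi a sigma : R) (P : 'M[R]_n)
    (hDelta : 0 <= Delta) (hn : (1 <= n)%N)
    (halo : 0 < alo) (hahi : 0 < ahi) (ha : 0 < a)
    (hP : posdef P) (hsigma : 0 < sigma) :
  exists2 cbar : R, 0 < cbar &
    forall (f0 : (R -> 'cV[R]_n) -> 'cV[R]_n) (V : (R -> 'cV[R]_n) -> R)
        (c : R),
      lipschitz_on_bounded Delta (@enorm R n) f0 ->
      f0 (fun=> 0) = 0 ->
      (forall phi, history Delta phi -> 0 <= V phi) ->
      lipschitz_on_bounded Delta (fun r : R => `|r|) V ->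
      (forall phi, history Delta phi ->
         alo * enorm (phi 0) ^+ 2 <= V phi <= ahi * hnorm Delta phi ^+ 2) ->
      (forall phi, history Delta phi ->
         (driver V phi (f0 phi) <=
            (- a * enorm (phi 0) ^+ 2 + c * hnorm Delta phi ^+ 2)%:E)%E) ->
      (forall phi, history Delta phi ->
         - sigma * hnorm Delta phi ^+ 2 <= ((phi 0)^T *m P *m f0 phi) 0 0) ->
      0 <= c < cbar ->
      GES Delta f0.
Proof.
have [l1 l10 Pl1] := posdef_lower_bound hP.
have [l2 l20 PC] := bilin_le P.
have Pl2 (v : 'cV[R]_n) : (v^T *m P *m v) 0 0 <= l2 * enorm v ^+ 2.
  by rewrite expr2 (le_trans (ler_norm _)).
(* Everything up to [T] is built before [f0], [V] and [c] are introduced, so [cbar] is uniform in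
   them. *)
pose g := gain alo ahi.
have g0 : 0 < g := gain_gt0 halo hahi.
pose eps := (8 * g)^-1.
have eps0 : 0 < eps by rewrite invr_gt0 mulr_gt0.
pose delta := l1 * eps / (8 * sigma * g).
have delta0 : 0 < delta by rewrite divr_gt0 ?mulr_gt0.
have delta_small : 8 * sigma * g * delta <= l1 * eps.
  by rewrite /delta mulrC divfK// gt_eqF// !mulr_gt0.
pose q := l1 * eps / (2 * l2).
have q0 : 0 < q by rewrite divr_gt0 ?mulr_gt0.
have aqd0 : 0 < a * q * delta by apply: mulr_gt0 => //; exact: mulr_gt0.
pose N := (Num.truncn ((2 * ahi + alo) / (a * q * delta))).+1.
have hN : 2 * ahi + alo < N%:R * (a * q * delta).
  have pos : 0 <= (2 * ahi + alo) / (a * q * delta).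
    by rewrite ltW// divr_gt0// addr_gt0// mulr_gt0.
  have /andP[_] := truncn_itv pos.
  by rewrite ltr_pdivrMr.
pose T := N%:R * (Delta + delta).
have T0 : 0 < T by rewrite mulr_gt0 ?ltr0n// ltr_wpDl.
(* For [c] below this value, [c * T <= alo / 2], as the growth bound requires. *)
exists (alo / (2 * T)); first by rewrite divr_gt0// mulr_gt0.
move=> f0 V c flip _ V0 Vlip Vbnd Vdrv Pgrowth /andP[c0 cT].
have cT2 : c * T <= alo / 2.
  rewrite -ler_pdivlMr// (le_trans (ltW cT))// le_eqVlt; apply/orP; left.
  by apply/eqP; field; rewrite gt_eqF.
apply: (@GES_of_decay R n Delta hDelta f0 (Num.sqrt (8 * g)) (ln 2 / T)) => //.
- by rewrite sqrtr_gt0 mulr_gt0.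
- by rewrite divr_gt0// ln_gt0// ltr1n.
move=> x tau xsol t ttau.
exact: (exponential_decay hDelta halo hahi ha c0 hsigma hP l10 l20 Pl1 Pl2 Vlip
  V0 Vbnd Vdrv Pgrowth (erefl eps) delta0 delta_small (erefl q) hN cT2 xsol ttau).
Qed.
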